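(* Let $(Z_t)_{t\ge0}$ be a subcritical continuous-time Bienaymé--Galton--Watson process and let $m>0$ be such that $\mathbf{E}_1[Z_t]=e^{-mt}$ for all $t\ge0$. Let $\nu_{\min}$ be its Yaglom limit and $H(z)=\sum_{n\ge1}\nu_{\min}(n)z^n$. Then: 1. There exist no non-trivial (i.e. $\not\equiv0$) true $\lambda$-invariant measures for $(Z_t)_{t\ge0}$ with $\lambda>0$. 2. The only true ($0$-)invariant measures for $(Z_t)_{t\ge0}$ are the multiples of $\delta_0$. 3. For $\lambda<0$, setting $\alpha=\lambda/m$, the true $\lambda$-invariant measures for $(Z_t)_{t\ge0}$ are exactly the multiples of the one with generating function $$z\mapsto\int_0^\infty e^{(H(z)-1)x}\frac{1}{x^\alpha}\,\frac{dx}{x},\qquad |z|<1,$$ i.e. the measures with generating functions $G(z)=c(1-H(z))^\alpha$, $c\ge0$.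
   Context: $\mathbb{N}=\{0,1,2,\ldots\}$, $\mathbb{N}^*=\{1,2,\ldots\}$. All measures are non-negative and locally finite; on $\mathbb{N}$ this means $\nu(n)<\infty$ for every $n$. $\mathbf{P}_1,\mathbf{E}_1$ denote law and expectation for the process started from $1$. Let $L_0$ and $(P^0_t)_{t\ge0}$ be the infinitesimal generator and semigroup of the non-killed process $(Z_t)_{t\ge0}$ on $\mathbb{N}$, for which $0$ is absorbing. A measure $\nu$ on $\mathbb{N}$, viewed as a row vector, is a true $\lambda$-invariant measure for $(Z_t)_{t\ge0}$ if $\nu L_0=-\lambda\nu$, or equivalently, if $\nu P^0_t=e^{-\lambda t}\nu$ for every $t\ge0$. The Yaglom limit is the probability measure $\nu_{\min}=\lim_{t\to\infty}\mathbf{P}_1(Z_t\in\cdot\mid Z_t>0)$ on $\mathbb{N}^*$ (weak limit), which is known to exist. The generating function of a measure $\nu$ on $\mathbb{N}$ is $G(z)=\sum_{n\ge0}\nu(n)z^n$, $|z|<1$. *)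

(* Defs.v *)
From HB Require Import structures.
From mathcomp Require Export all_boot all_order all_algebra.
From mathcomp Require Export complex.
From mathcomp Require Export all_classical all_reals all_analysis.
Export numFieldNormedType.Exports.

Set Implicit Arguments.
Unset Strict Implicit.
Unset Printing Implicit Defensive.
Import Order.TTheory GRing.Theory Num.Theory.

Local Open Scope classical_set_scope.
Local Open Scope ring_scope.
Local Open Scope complex_scope.

Section BGW.
Variable R : realType.
Implicit Types (p : nat -> R) (P : R -> nat -> nat -> R) (L : nat -> nat -> R).

Definition is_pmf p := (forall n, 0 <= p n) /\ series p @ \oo --> (1 : R).

(* Each of the [i] individuals independently, at rate [r], is replaced by [k]
   individuals with probability [p k], so that i jumps to i + k - 1 at rate
   i * r * p k. The state 0 is not killed: its row is zero. *)
Definition bgw_generator (r : R) p (i j : nat) : R :=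
  i%:R * r * ((if (i <= j.+1)%N then p (j.+1 - i)%N else 0) - (i == j)%:R).

Record is_transition_semigroup P : Prop := {
  semigroup_pmf : forall (t : R) i, 0 <= t -> is_pmf (P t i);
  semigroup0 : forall i j, P 0 i j = (i == j)%:R;
  chapman_kolmogorov : forall (s t : R) i j, 0 <= s -> 0 <= t ->
    series (fun k => P s i k * P t k j) @ \oo --> P (s + t) i j
}.

Definition is_infinitesimal_generator L P := forall i j : nat,
  (h^-1 * (P h i j - (i == j)%:R)) @[h --> (0 : R)^'+] --> L i j.

(* [Z] started from i + i' is the sum of two independent copies of [Z] started
   from i and i'. *)
Definition branching_property P := forall (t : R) i i' j, 0 <= t ->
  P t (i + i')%N j = \sum_(k < j.+1) P t i k * P t i' (j - k)%N.

(* Probability of visiting [y1] at time [t1], [y2] at time [t2], ... for the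
   list [:: (t1, y1); (t2, y2); ...], starting from [x] at time [s]. *)
Fixpoint finite_dim_proba P (s : R) (x : nat) (l : seq (R * nat)) : R :=
  if l is (t, y) :: l' then P (t - s) x y * finite_dim_proba P t y l' else 1.

(* Under [Pr x], [Z] is a time-homogeneous Markov process started from [x]
   with transition function [P]. *)
Definition is_markov_process d (T : measurableType d)
    (Pr : nat -> probability T R) (Z : R -> T -> nat) P :=
  (forall t : R, 0 <= t -> measurable_fun [set: T] (Z t)) /\
  (forall (x : nat) (l : seq (R * nat)),
    path <=%R 0 [seq ty.1 | ty <- l] ->
    Pr x [set w | all (fun ty => Z ty.1 w == ty.2) l] =
    (finite_dim_proba P 0 x l)%:E).

(* Continuous-time Bienaymé-Galton-Watson process with branching rate [r],
   offspring law [p] and transition semigroup [P]; [Pr x] is its law when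
   started from [x]. *)
Record is_BGW (r : R) p P d (T : measurableType d)
    (Pr : nat -> probability T R) (Z : R -> T -> nat) : Prop := {
  bgw_rate_gt0 : 0 < r;
  bgw_offspring : is_pmf p;
  bgw_semigroup : is_transition_semigroup P;
  bgw_branching : branching_property P;
  bgw_absorbing0 : forall t : R, 0 <= t -> P t 0%N 0%N = 1;
  bgw_infinitesimal : is_infinitesimal_generator (bgw_generator r p) P;
  bgw_markov : is_markov_process Pr Z P
}.

Definition subcritical p := (\sum_(0 <= k <oo) (k%:R * p k)%:E < 1)%E.

(* Weak convergence of P1(Z_t \in . | Z_t > 0) to [nu] on {1, 2, ...}: every
   function on this discrete space is continuous, so the test functions are
   all bounded ones (their value at 0 is irrelevant). *)
Definition is_yaglom_limit d (T : measurableType d) (P1 : probability T R)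
    (Z : R -> T -> nat) (nu : probability nat R) :=
  nu [set 0%N] = 0%E /\
  forall f : nat -> R, (exists M : R, forall n, `|f n| <= M) ->
    (\int[P1]_(w in [set w | (0 < Z t w)%N]) f (Z t w)) /
      fine (P1 [set w | (0 < Z t w)%N]) @[t --> +oo]
    --> \int[nu]_n f n.

Implicit Types nu : {measure set nat -> \bar R}.

Definition locally_finite nu := forall n : nat, (nu [set n] < +oo)%E.

Definition mass nu (n : nat) : R := fine (nu [set n]).

(* nu L = - lambda nu, with [nu] viewed as a row vector. *)
Definition true_invariant L (lambda : R) nu := forall j : nat,
  series (fun i => mass nu i * L i j) @ \oo --> - lambda * mass nu j.

Definition has_generating_function nu (G : R[i] -> R[i]) :=
  forall z : R[i], `|z| < 1 ->
    series (fun n => ((mass nu n)%:C * z ^+ n : R[i]^o)) @ \oo -->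
    (G z : R[i]^o).

Definition cexp (z : R[i]) : R[i] :=
  (expR (complex.Re z))%:C * (cos (complex.Im z) +i* sin (complex.Im z)).

(* Principal logarithm, on the half-plane Re w > 0 only. *)
Definition clog (w : R[i]) : R[i] :=
  ln (complex.Re `|w|) +i* atan (complex.Im w / complex.Re w).

Definition cpow (w : R[i]) (a : R) : R[i] := cexp (a%:C * clog w).

Definition cintegral (D : set R) (f : R -> R[i]) : R[i] :=
  (\int[lebesgue_measure]_(x in D) complex.Re (f x)) +i*
  (\int[lebesgue_measure]_(x in D) complex.Im (f x)).

End BGW.

(* Main.v *)
From mathcomp Require Import measurable_realfun ring lra zify.
Require Import Defs.

Set Implicit Arguments.
Unset Strict Implicit.
Unset Printing Implicit Defensive.
Import Order.TTheory GRing.Theory Num.Theory.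

Local Open Scope classical_set_scope.
Local Open Scope ring_scope.
Local Open Scope complex_scope.

(** Write h for the masses of the Yaglom limit, H for its generating function,
    u_k = r (p_k - [k = 1]) and beta = - alpha > 0.

    The series (nu L0)(n) has finitely many terms: it is the n-th coefficient
    of the product of the formal series G' (the derivative of the generating
    function of nu) and u, so that invariance reads G' u = - lambda G
    ([true_invariantE]).  Subcriticality forces p_0 > 0, hence u_0 is
    invertible and the equation is a recursion which determines nu from nu(0)
    ([eigen_unique]).  At n = 0 it reads r p_0 nu(1) = - lambda nu(0), with
    nu(0), nu(1) >= 0: hence nu(0) = 0 when lambda > 0, and nu(1) = 0 when
    lambda = 0.  This settles the first two claims, and shows that for
    lambda < 0 the solutions form a line.  The point is then to exhibit a
    nonnegative solution and to identify it with (1 - H)^alpha.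

    - The Yaglom limit satisfies H' u = m (1 - H) ([yaglom_generator]).  By
      the branching property, the survival probability S satisfies
      S(s + t) = E_1[1 - (1 - S(t))^(Z_s)], and since S(t) tends to 0 the
      ratio S(s + t) / S(t) tends to the mean e^(- m s).  Letting t tend to
      infinity in the Chapman-Kolmogorov equation, divided by S(t), shows that
      h is quasi-stationary with rate m; differentiate at s = 0.

    - The formal series a of (1 - H)^(- beta) is defined by the recursion
      contained in (1 - H) a' = beta H' a ([neg_power]), all of whose
      coefficients are nonnegative.  Multiplying by u gives
      (1 - H) (a' u - beta m a) = 0, so a' u = beta m a = - lambda a
      ([neg_power_eigen]).

    - In the unit disc the sum of a is the complex power (1 - H(z))^(- beta)
      ([neg_power_cpow]): truncate both series to polynomials, and observe
      that along the ray from 0 to z the product of the truncated a by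
      (1 - H)^beta has a derivative bounded by the tail of a convergent
      series.

    - The integral of e^((H(z) - 1) x) x^(beta - 1) over x > 0 equals
      Gamma(beta) (1 - H(z))^(- beta) ([cintegral_cexp_gamma]): expand
      e^(w x), w = H(z), integrate term by term by dominated convergence, and
      sum the resulting binomial series in w by [neg_power_cpow] again, for
      the Dirac mass at 1 instead of h. *)

(** * Formal power series and their negative powers *)

Section FormalSeries.
Variable R : comNzRingType.
Implicit Types a b c d : nat -> R.

(** Product of the formal power series with coefficients [a] and [b]. *)
Definition conv a b (n : nat) : R := \sum_(k < n.+1) a k * b (n - k)%N.

Definition fderiv a (n : nat) : R := n.+1%:R * a n.+1.

(** Low coefficients of a product only see truncations, so polynomials provide the
    ring axioms for formal series. *)
Lemma convE a b (N n : nat) : (n < N)%N ->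
  conv a b n = ((\poly_(i < N) a i) * (\poly_(i < N) b i))`_n.
Proof.
move=> nN; rewrite coefM; apply: eq_bigr => k _.
have kn : (k <= n)%N by rewrite -ltnS.
by rewrite !coef_poly (leq_ltn_trans kn nN) (leq_ltn_trans (leq_subr _ _) nN).
Qed.

Lemma convC a b : conv a b =1 conv b a.
Proof. by move=> n; rewrite !(convE _ _ (ltnSn n)) mulrC. Qed.

Lemma eq_conv a b c d n : (forall k, (k <= n)%N -> a k = b k) ->
  (forall k, (k <= n)%N -> c k = d k) -> conv a c n = conv b d n.
Proof.
move=> ab cd; apply: eq_bigr => k _.
by rewrite ab ?cd ?leq_subr // -ltnS.
Qed.

Lemma convA a b c : conv a (conv b c) =1 conv (conv a b) c.
Proof.
move=> n.
have coefMlow (p q p' : {poly R}) : (forall k, (k <= n)%N -> p`_k = p'`_k) ->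
    (p * q)`_n = (p' * q)`_n.
  by move=> pp'; rewrite !coefM; apply: eq_bigr => k _; rewrite pp' // -ltnS.
rewrite convC !(convE _ _ (ltnSn n)).
rewrite (coefMlow _ _ (\poly_(i < n.+1) b i * \poly_(i < n.+1) c i)); last first.
  by move=> k kn; rewrite coef_poly ltnS kn (convE _ _ (_ : k < n.+1)%N).
rewrite [RHS](coefMlow _ _ (\poly_(i < n.+1) a i * \poly_(i < n.+1) b i)).
  by rewrite mulrC mulrA.
by move=> k kn; rewrite coef_poly ltnS kn (convE _ _ (_ : k < n.+1)%N).
Qed.

Lemma conv_inj d a b : d 0%N = 1 -> conv d a =1 conv d b -> a =1 b.
Proof.
move=> d0 dab n; have [N] := ubnP n; elim: N n => // N IH n nN.
have := dab n; rewrite /conv !big_ord_recl !d0 !mul1r subn0.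
rewrite (eq_bigr (fun i : 'I_n => d (lift ord0 i) * b (n - lift ord0 i)%N)).
  by move/addIr.
by move=> i _; rewrite IH // lift0; have := ltn_ord i; lia.
Qed.

End FormalSeries.

Section NegPower.
Variable R : realType.
Implicit Types (h a u p : nat -> R) (beta : R).

(** The formal series [a] is [(1 - h) ^ (- beta)]: comparing coefficients in
    [(1 - h) * a' = beta * h' * a] gives this recursion when [h 0 = 0].  In this form its
    coefficients are visibly nonnegative. *)
Definition neg_power beta h a := a 0%N = 1 /\ forall n,
  n.+1%:R * a n.+1 =
  \sum_(i < n.+1) (i%:R + beta * (n.+1 - i)%:R) * h (n.+1 - i)%N * a i.

Lemma recursive_seq (F : nat -> nat -> R) : exists a : nat -> R,
  a 0%N = 1 /\ forall n, a n.+1 = \sum_(i < n.+1) F n i * a i.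
Proof.
pose step n (l : seq R) := rcons l (\sum_(i < n.+1) F n i * nth 0 l i).
pose l := fix l n := if n is n'.+1 then step n' (l n') else [:: 1].
have size_l n : size (l n) = n.+1.
  by elim: n => //= n IH; rewrite size_rcons IH.
have nth_l n k : (k <= n)%N -> nth 0 (l n) k = nth 0 (l k) k.
  elim: n => [|n IH]; first by rewrite leqn0 => /eqP ->.
  rewrite leq_eqVlt => /predU1P[-> //|]; rewrite ltnS => kn.
  by rewrite /= nth_rcons size_l ltnS kn IH.
exists (fun n => nth 0 (l n) n); split=> // n.
rewrite /= nth_rcons size_l ltnn eqxx; apply: eq_bigr => i _.
by rewrite nth_l // -ltnS.
Qed.

Lemma neg_power_exists beta h : exists a, neg_power beta h a.
Proof.
have [a [a0 aS]] := recursive_seq (fun n i =>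
  n.+1%:R^-1 * ((i%:R + beta * (n.+1 - i)%:R) * h (n.+1 - i)%N)).
exists a; split=> // n; rewrite aS mulr_sumr; apply: eq_bigr => i _.
by rewrite [LHS]mulrA mulVKf // pnatr_eq0.
Qed.

Lemma neg_power_ge0 beta h a : 0 <= beta -> (forall n, 0 <= h n) ->
  neg_power beta h a -> forall n, 0 <= a n.
Proof.
move=> b0 h0 [a0 aS] n; have [N] := ubnP n; elim: N n => // N IH [|n] nN.
  by rewrite a0.
rewrite -(pmulr_rge0 _ (ltr0Sn _ n)) aS sumr_ge0 // => i _.
rewrite mulr_ge0 ?mulr_ge0 // ?addr_ge0 ?mulr_ge0 //.
by rewrite IH // (leq_trans (ltn_ord i)).
Qed.

(** The recursion, back in the form [a' = h * a' + beta * h' * a]. *)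
Lemma neg_power_conv beta h a : h 0%N = 0 -> neg_power beta h a -> forall n,
  fderiv a n = conv h (fderiv a) n + beta * conv (fderiv h) a n.
Proof.
move=> h0 [a0 aS] n; rewrite {1}/fderiv aS.
under eq_bigr => i _ do rewrite !mulrDl.
rewrite big_split /=; congr (_ + _).
  rewrite big_ord_recl/= !mul0r add0r convC /conv big_ord_recr/= subnn h0 mulr0.
  by rewrite addr0; apply: eq_bigr => i _; rewrite /fderiv /bump add1n subSS; ring.
rewrite convC /conv mulr_sumr; apply: eq_bigr => i _.
by rewrite /fderiv subSn -1?ltnS //; ring.
Qed.

(** The radius of convergence of [a] is at least 1.  In the recursion for
    [a n * rho ^ n], the weight [(i + beta * k) * rho ^ k], with [i + k = n], is at most [n]
    once [(1 + beta / n) * rho <= 1], by Bernoulli's inequality; from then on each term is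
    dominated by the previous ones. *)
Lemma neg_power_bounded beta h a (rho : R) : 0 <= beta ->
  (forall n, 0 <= h n) -> (forall n, \sum_(i < n) h i <= 1) ->
  neg_power beta h a -> 0 <= rho < 1 ->
  exists K, forall n, a n * rho ^+ n <= K.
Proof.
move=> b0 h0 h1 ha /andP[r0 r1]; have a_ge0 := neg_power_ge0 b0 h0 ha.
case: ha => a0 aS.
(* from N on, (1 + beta / n) rho <= 1 *)
have [N /andP[N0 Nr]] : exists N, (0 < N)%N && ((1 + beta / N%:R) * rho <= 1).
  have := @cvg_harmonic R => hc.
  have : (1 + beta * harmonic n) * rho @[n --> \oo] --> (1 + beta * 0) * rho.
    by apply: cvgMl; apply: cvgD; [exact: cvg_cst|exact: cvgMr].
  rewrite mulr0 addr0 mul1r => /cvgr_lt /(_ _ r1) [N _ /(_ N (leqnn _)) /= HN].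
  by exists N.+1; rewrite /= ltW.
exists (\sum_(i < N.+1) a i * rho ^+ i) => n.
have [M] := ubnP n; elim: M n => // M IH n nM.
have [nN|Nn] := leqP n N.
  rewrite (bigD1 (Ordinal (nN : (n < N.+1)%N))) //= lerDl sumr_ge0 // => i _.
  by rewrite mulr_ge0 // exprn_ge0.
case: n Nn nM => // n Nn nM.
set K := \sum_(i < N.+1) _ in IH *.
have K0 : 0 <= K by rewrite sumr_ge0 // => i _; rewrite mulr_ge0 // exprn_ge0.
rewrite -(ler_pM2l (ltr0Sn _ n)) mulrA aS mulr_suml.
apply: (@le_trans _ _ (\sum_(i < n.+1) n.+1%:R * K * h (n.+1 - i)%N)).
  apply: ler_sum => i _; set k := (n.+1 - i)%N.
  have kn : n.+1 = (k + i)%N by rewrite subnK // ltnW.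
  have -> : rho ^+ n.+1 = rho ^+ k * rho ^+ i by rewrite -exprD -kn.
  rewrite [leLHS](_ : _ = ((i%:R + beta * k%:R) * rho ^+ k) * (a i * rho ^+ i) * h k);
    last by ring.
  rewrite ler_wpM2r // ler_pM //.
  - by rewrite mulr_ge0 ?exprn_ge0 // addr_ge0 // mulr_ge0.
  - by rewrite mulr_ge0 // exprn_ge0.
  - have bern : 1 + (beta / N%:R) * k%:R <= (1 + beta / N%:R) ^+ k.
      have x0 : 0 <= beta / N%:R by rewrite divr_ge0.
      elim: (k) => [|j IHj]; first by rewrite mulr0 addr0 expr0.
      rewrite exprS; apply: (@le_trans _ _ ((1 + beta / N%:R) * (1 + beta / N%:R * j%:R))).
        rewrite -natr1; have : 0 <= (beta / N%:R) * (beta / N%:R) * j%:R by rewrite !mulr_ge0.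
        by lra.
      by rewrite ler_pM2l // ltr_wpDr.
    apply: (@le_trans _ _ (n.+1%:R * ((1 + beta / N%:R) * rho) ^+ k)); last first.
      by rewrite ler_piMr // exprn_ile1 // mulr_ge0 // addr_ge0 // divr_ge0.
    rewrite exprMn mulrA ler_wpM2r ?exprn_ge0 //.
    apply: (@le_trans _ _ (n.+1%:R * (1 + beta / N%:R * k%:R))); last first.
      by rewrite ler_pM2l // ltr0Sn.
    rewrite mulrDr mulr1 lerD //; first by rewrite ler_nat ltnW.
    rewrite mulrA ler_wpM2r // mulrCA ler_peMr // ler_pdivlMr ?ltr0n // mul1r.
    by rewrite ler_nat ltnW.
  - by apply: IH; rewrite -ltnS (leq_trans _ nM) // ltnS.
rewrite -mulr_sumr ler_piMr //; first by rewrite mulr_ge0.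
rewrite (reindex_inj rev_ord_inj) /=.
apply: le_trans (h1 n.+2).
rewrite [leRHS]big_ord_recl ler_wpDl //.
by apply: ler_sum => i _; rewrite lift0 subKn.
Qed.

(** If [h' * u = m * (1 - h)] then [a' * u = beta * m * a]: multiply
    [(1 - h) * a' = beta * h' * a] by [u], and cancel the invertible series [1 - h]. *)
Lemma neg_power_eigen beta m h a u : h 0%N = 0 -> neg_power beta h a ->
  (forall n, conv (fderiv h) u n = m * ((n == 0)%:R - h n)) ->
  forall n, conv (fderiv a) u n = beta * m * a n.
Proof.
move=> h0 ha hu.
pose d n : R := (n == 0)%:R - h n.
have dE b n : conv d b n = b n - conv h b n.
  rewrite /conv /d.
  under eq_bigr => i _ do rewrite mulrBl.
  rewrite big_split /= sumrN big_ord_recl /= mul1r subn0 big1 ?addr0 //.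
  by move=> i _; rewrite mul0r.
apply: (@conv_inj _ d); first by rewrite /d eqxx h0 subr0.
move=> n; rewrite convA.
rewrite (eq_conv (b := fun k => beta * conv (fderiv h) a k) (d := u)) //; last first.
  by move=> k _; rewrite dE {1}(neg_power_conv h0 ha) addrAC subrr add0r.
transitivity (beta * conv (conv (fderiv h) a) u n).
  by rewrite mulr_sumr; apply: eq_bigr => k _; rewrite mulrA.
rewrite -convA -(eq_conv (a := fderiv h) (c := conv u a)) //; last first.
  by move=> k _; rewrite convC.
rewrite convA (eq_conv (b := fun k => m * d k) (d := a)) //.
rewrite !mulr_sumr; apply: eq_bigr => k _; ring.
Qed.

End NegPower.

(** * The generator as a product of formal series *)

Lemma cvg_near_eq (R : realType) (T : Type) (F : set_system T)
    (FF : Filter F) (f g : T -> R) (l : R) :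
  (\forall x \near F, f x = g x) -> f @ F --> l -> g @ F --> l.
Proof. by move=> fg; apply: cvg_trans; exact: near_eq_cvg. Qed.

Section Generator.
Variable R : realType.
Implicit Types (a b p u : nat -> R) (nu : {measure set nat -> \bar R}).

Lemma cvg_series_finite (f : nat -> R) N l : (forall i, (N <= i)%N -> f i = 0) ->
  series f @ \oo --> l <-> \sum_(i < N) f i = l.
Proof.
move=> f0.
have c : series f @ \oo --> \sum_(i < N) f i.
  apply: cvg_near_cst; near=> n.
  have Nn : (N <= n)%N by near: n; exact: nbhs_infty_ge.
  rewrite /series /= (big_cat_nat (n := N)) //= big_mkord -[RHS]addr0.
  congr (_ + _); rewrite big_nat_cond big1 // => i.
  by rewrite andbT => /andP[Ni _]; rewrite f0.
split=> [cl|<- //].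
exact: (cvg_unique _ c cl).
Unshelve. all: by end_near. Qed.

(** Coefficients of [r * (f(z) - z)], with [f] the generating function of [p]. *)
Definition drift (r : R) p (k : nat) : R := r * (p k - (k == 1%N)%:R).

Lemma bgw_generatorS r p i j : bgw_generator r p i.+1 j =
  if (i <= j)%N then i.+1%:R * drift r p (j - i)%N else 0.
Proof.
rewrite /bgw_generator /drift ltnS; have [ij|ji] := leqP i j.
  rewrite subSS -mulrA; congr (_ * (_ * (_ - _%:R))).
  by apply/eqP/eqP; lia.
by rewrite [i.+1 == j]gtn_eqF ?subr0 ?mulr0 // ltnS ltnW.
Qed.

Lemma sum_bgw_generator r p a n :
  \sum_(i < n.+2) a i * bgw_generator r p i n =
  conv (fderiv a) (drift r p) n.
Proof.
rewrite big_ord_recl /bgw_generator !mul0r mulr0 add0r.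
apply: eq_bigr => i _; rewrite lift0 -/(bgw_generator r p i.+1 n) bgw_generatorS.
by rewrite -ltnS ltn_ord /fderiv mulrA [a _ * _]mulrC.
Qed.

Lemma true_invariantE r p (lambda : R) nu :
  true_invariant (bgw_generator r p) lambda nu <->
  forall n, conv (fderiv (mass nu)) (drift r p) n = - lambda * mass nu n.
Proof.
have Z n i : (n.+2 <= i)%N -> mass nu i * bgw_generator r p i n = 0.
  by case: i => // i ni; rewrite bgw_generatorS leqNgt -ltnS ni mulr0.
split=> h n.
  by rewrite -sum_bgw_generator; apply/(cvg_series_finite _ (Z n)).
by apply/(cvg_series_finite _ (Z n)); rewrite sum_bgw_generator.
Qed.

(** The coefficient of [a n.+1] in the [n]-th equation is [u 0 * n.+1], so that the
    equations are solved one after the other from [a 0]. *)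
Lemma eigen_unique u theta a b : u 0%N != 0 ->
  (forall n, conv (fderiv a) u n = theta * a n) ->
  (forall n, conv (fderiv b) u n = theta * b n) ->
  a 0%N = b 0%N -> a =1 b.
Proof.
move=> u0 ha hb ab0 n; have [N] := ubnP n; elim: N n => // N IH [//|n] nN.
have := hb n; rewrite -(IH n) //.
rewrite -ha /conv !big_ord_recr /= subnn.
rewrite (eq_bigr (fun i : 'I_n => fderiv a i * u (n - i)%N)); last first.
  by move=> i _; rewrite /fderiv IH //; have := ltn_ord i; lia.
move/addrI/(mulIf u0)/eqP; rewrite /fderiv eq_sym (inj_eq (mulfI _)) ?pnatr_eq0 //.
by move/eqP.
Qed.

(** Without deaths every individual leaves at least one child, and the mean is at
    least 1. *)
Lemma subcritical_p0 p : is_pmf p -> subcritical p -> 0 < p 0%N.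
Proof.
move=> [p_ge0 p1] hs; rewrite lt_def p_ge0 andbT; apply/eqP => p0.
suff : ((1 : R)%:E <= \sum_(0 <= k <oo) (k%:R * p k)%:E)%E.
  by rewrite leNgt => /negP; apply.
have -> : (1 : R)%:E = (\sum_(0 <= k <oo) (p k)%:E)%E.
  apply/esym/cvg_lim => //.
  rewrite (_ : (fun n : nat => _) = EFin \o series p).
    by apply: cvg_EFin => //; apply: nearW.
  by apply/funext => n; rewrite /= /series /= sumEFin.
apply: lee_nneseries => [k _|k _]; first by rewrite lee_fin.
rewrite lee_fin; case: k => [|k]; first by rewrite p0 mulr0.
by rewrite ler_peMl // ler1n.
Qed.

Lemma measure_natE nu (A : set nat) :
  (nu A = \sum_(n <oo | n \in A) nu [set n])%E.
Proof.
rewrite -measure_bigcup //; last first.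
  by move=> i j _ _ [k [-> ->]].
by congr (nu _); apply/seteqP; split=> [n An|n [m Am ->//]]; exists n.
Qed.

Lemma mass_ge0 nu n : 0 <= mass nu n.
Proof. exact: fine_ge0. Qed.

Lemma massE nu n : locally_finite nu -> nu [set n] = (mass nu n)%:E.
Proof. by move=> h; rewrite /mass fineK // ge0_fin_numE. Qed.

Lemma massZ_measure nu nu' (c : R) : 0 <= c ->
  locally_finite nu -> locally_finite nu' ->
  (forall n, mass nu n = c * mass nu' n) <->
  (forall A, nu A = c%:E * nu' A)%E.
Proof.
move=> c0 h h'; split=> [e A|e n]; last by rewrite /mass e massE.
rewrite !measure_natE -nneseriesZl //.
by apply: eq_eseriesr => n _; rewrite !massE // e.
Qed.

Lemma measure_of_mass a : (forall n, 0 <= a n) ->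
  exists nu : {measure set nat -> \bar R}, locally_finite nu /\ mass nu =1 a.
Proof.
move=> a0.
pose nu : {measure set nat -> \bar R} :=
  mseries (fun n => mscale (NngNum (a0 n)) (dirac n)) 0%N.
have nuE n : nu [set n] = (a n)%:E.
  rewrite /nu /= /mseries (@nneseriesD1 _ _ n) //.
  rewrite eseries0 ?adde0 /=; last first.
    move=> i _ /= ni; rewrite /mscale /= diracE memNset ?mule0 //= => in_eq.
    by rewrite in_eq eqxx in ni.
  by rewrite /mscale /= diracE mem_set ?mule1.
by exists nu; split=> n; rewrite ?/mass nuE ?ltry.
Qed.

End Generator.

(** * Integration against the law of an integer-valued variable *)

Section Law.
Context (R : realType) (d : measure_display) (T : measurableType d).
Variables (mu : probability T R) (X : T -> nat) (w : nat -> R).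
Hypothesis mX : measurable_fun [set: T] X.
Hypothesis muX : forall k, mu (X @^-1` [set k]) = (w k)%:E.

Lemma ge0_integral_law (g : nat -> R) : (forall k, 0 <= g k) ->
  (\int[mu]_x (g (X x))%:E = \sum_(0 <= k <oo) (g k * w k)%:E)%E.
Proof.
move=> g0.
have mXk k : measurable (X @^-1` [set k]) by rewrite -[_ @^-1` _]setTI; exact: mX.
have -> : [set: T] = \bigcup_k X @^-1` [set k].
  by apply/seteqP; split=> // x _; exists (X x).
rewrite ge0_integral_bigcup //.
- apply: eq_eseriesr => k _.
  under eq_integral => x /set_mem /= -> do [].
  by rewrite integral_cst //= muX.
- apply/measurable_EFinP.
  have mg : measurable_fun [set: nat] g by [].
  by apply: (measurable_funTS (measurableT_comp mg mX)).
- by move=> x _; rewrite lee_fin.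
- by move=> i j _ _ [x [/= <- <-]].
Qed.

Lemma law_ge0 k : 0 <= w k.
Proof. by rewrite -lee_fin -muX. Qed.

Lemma cvg_law_integral (g : nat -> R) (M : R) : (forall k, 0 <= g k <= M) ->
  series (fun k => g k * w k) @ \oo --> \int[mu]_x g (X x).
Proof.
move=> gM; have g0 k : 0 <= g k by case/andP: (gM k).
have mXk k : measurable (X @^-1` [set k]) by rewrite -[_ @^-1` _]setTI; exact: mX.
have fin : (\int[mu]_x (g (X x))%:E)%E \is a fin_num.
  rewrite ge0_fin_numE; last by apply: integral_ge0 => x _; rewrite lee_fin.
  apply: (@le_lt_trans _ _ (\int[mu]_(x in [set: T]) M%:E)%E).
    apply: ge0_le_integral => //.
    - by move=> x _; rewrite lee_fin.
    - apply/measurable_EFinP.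
      have mg : measurable_fun [set: nat] g by [].
      by apply: (measurable_funTS (measurableT_comp mg mX)).
    - by move=> x _; rewrite lee_fin; case/andP: (gM (X x)).
  by rewrite integral_cst //= probability_setT mule1 ltry.
apply: (@fine_cvg _ _ _ _ (EFin \o series (fun k => g k * w k))).
rewrite fineK // ge0_integral_law //.
rewrite (_ : _ \o _ = fun n => \sum_(0 <= k < n) (g k * w k)%:E)%E; last first.
  by apply/funext => n; rewrite /= /series /= sumEFin.
by apply: is_cvg_nneseries => k _ _; rewrite lee_fin mulr_ge0 ?law_ge0.
Qed.

Lemma cvg_law_integral_pos (g : nat -> R) (M : R) : (forall k, 0 <= g k <= M) ->
  g 0%N = 0 -> series (fun k => g k * w k) @ \oo -->
  \int[mu]_(x in [set x | (0 < X x)%N]) g (X x).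
Proof.
move=> gM g0; rewrite Rintegral_mkcond.
rewrite (_ : (fun x => g (X x)) \_ _ = fun x => g (X x)).
  exact: cvg_law_integral gM.
apply/funext => x; rewrite patchE; case: ifPn => //.
rewrite notin_setE /= => /negP; rewrite -leqNgt leqn0 => /eqP ->.
by rewrite g0.
Qed.

Lemma law_cvg1 : series w @ \oo --> (1 : R).
Proof.
have := @cvg_law_integral (fun=> 1) 1 (fun=> _).
rewrite (_ : (fun k => 1 * w k) = w); last by apply/funext => k; rewrite mul1r.
have -> : \int[mu]_x (1 : R) = 1.
  by rewrite [LHS]Rintegral_cst //= -[X in fine X]/(mu setT) probability_setT mulr1.
by apply=> _; rewrite ler01 lexx.
Qed.

Lemma cvg_law_expectation (e : R) :
  'E_mu[(fun x => (X x)%:R : R)]%E = e%:E ->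
  series (fun k => k%:R * w k) @ \oo --> e.
Proof.
rewrite unlock (ge0_integral_law (fun k => ler0n R k)) => eE.
apply: (@fine_cvg _ _ _ _ (EFin \o series (fun k => k%:R * w k))).
rewrite -eE (_ : _ \o _ = fun n => \sum_(0 <= k < n) (k%:R * w k)%:E)%E; last first.
  by apply/funext => n; rewrite /= /series /= sumEFin.
by apply: is_cvg_nneseries => k _ _; rewrite lee_fin mulr_ge0 ?law_ge0.
Qed.

Lemma law_gt0E : mu [set x | (0 < X x)%N] = (1 - w 0%N)%:E.
Proof.
have mX0 : measurable (X @^-1` [set 0%N]) by rewrite -[_ @^-1` _]setTI; exact: mX.
rewrite (_ : [set x | _] = ~` (X @^-1` [set 0%N])).
  by rewrite probability_setC //= muX.
by apply/seteqP; split=> x /=; rewrite lt0n => /eqP.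
Qed.

End Law.

(** * From the branching property to the eigenvalue equation of the Yaglom limit *)

Section Branching.
Variable R : realType.
Implicit Types (q : nat -> R) (s t x : R).

Lemma sum_le_cvg_series (f : nat -> R) (l : R) n : (forall k, 0 <= f k) ->
  series f @ \oo --> l -> \sum_(k < n) f k <= l.
Proof.
move=> f0 fl; rewrite -(cvg_lim _ fl) // -(big_mkord xpredT).
have cf : cvgn (series f) by apply/cvg_ex; exists l.
apply: (nondecreasing_cvgn_le _ cf n).
by apply: nondecreasing_series => k _ _; exact: f0.
Qed.

Lemma cvg_series_le (f : nat -> R) (l M : R) :
  (forall n, \sum_(k < n) f k <= M) -> series f @ \oo --> l -> l <= M.
Proof.
move=> fM fl; rewrite -(cvg_lim _ fl) //; apply: limr_le.
  by apply/cvg_ex; exists l.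
by apply: nearW => n; rewrite /series /= big_mkord.
Qed.

Lemma pmf_sum_le1 q n : is_pmf q -> \sum_(k < n) q k <= 1.
Proof. by move=> [q0 q1]; exact: sum_le_cvg_series. Qed.

Lemma pmf_le1 q k : is_pmf q -> q k <= 1.
Proof.
move=> hq; apply: le_trans (pmf_sum_le1 k.+1 hq).
by rewrite big_ord_recr /= ler_wpDl // sumr_ge0 // => i _; case: hq.
Qed.

Lemma pmf_point q j : is_pmf q -> q 0%N = 1 -> q j = (j == 0)%:R.
Proof.
move=> hq q0; case: j => [//|j]; apply: le_anti.
have -> : (0 <= q j.+1)%R by case: hq.
rewrite andbT; have := pmf_sum_le1 j.+2 hq.
rewrite big_ord_recl q0 gerDl; apply: le_trans.
by rewrite big_ord_recr /= ler_wpDl // sumr_ge0 // => i _; case: hq.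
Qed.

Lemma expr1B_ge (x : R) k : 0 <= x <= 1 -> 1 - k%:R * x <= (1 - x) ^+ k.
Proof.
move=> /andP[x0 x1]; elim: k => [|k IH]; first by rewrite mul0r subr0.
rewrite exprS; apply: (@le_trans _ _ ((1 - x) * (1 - k%:R * x))).
  rewrite -natr1; have : 0 <= k%:R * (x * x) by rewrite !mulr_ge0.
  by lra.
by rewrite ler_wpM2l // subr_ge0.
Qed.

Lemma expr1B_le (x : R) k : 0 <= x <= 1 ->
  (1 - x) ^+ k <= 1 - k%:R * x + k%:R ^+ 2 * x ^+ 2.
Proof.
move=> /andP[x0 x1]; elim: k => [|k IH]; first by rewrite expr0 expr2 !mul0r subr0 addr0.
rewrite exprS; apply: (@le_trans _ _ ((1 - x) * (1 - k%:R * x + k%:R ^+ 2 * x ^+ 2))).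
  by rewrite ler_wpM2l // subr_ge0.
rewrite -natr1.
have : 0 <= k%:R * x ^+ 2 by rewrite mulr_ge0 ?sqr_ge0.
have : 0 <= k%:R ^+ 2 * x ^+ 3 by rewrite mulr_ge0 ?sqr_ge0 ?exprn_ge0.
have : 0 <= x ^+ 2 by rewrite sqr_ge0.
set y : R := k%:R => H1 H2 H3.
rewrite -subr_ge0 (_ : _ - _ = y ^+ 2 * x ^+ 3 + (x ^+ 2 + y * x ^+ 2)); last by ring.
by rewrite !addr_ge0.
Qed.

Variable P : R -> nat -> nat -> R.
Hypothesis hP : is_transition_semigroup P.
Hypothesis hB : branching_property P.
Hypothesis h0 : forall t : R, 0 <= t -> P t 0%N 0%N = 1.

Lemma transition_ge0 t i j : 0 <= t -> 0 <= P t i j.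
Proof. by move=> t0; have [] := semigroup_pmf hP i t0. Qed.

Lemma absorbing0 t j : 0 <= t -> P t 0%N j = (j == 0)%:R.
Proof. by move=> t0; apply: pmf_point (h0 t0); exact: semigroup_pmf. Qed.

Lemma extinctionX t k : 0 <= t -> P t k 0%N = P t 1%N 0%N ^+ k.
Proof.
move=> t0; elim: k => [|k IH]; first by rewrite h0.
by rewrite -add1n hB // big_ord1 IH exprS.
Qed.

(** Chernoff's bound: [Z] started from [k] is the sum of [k] independent copies, so
    its generating function is the [k]-th power of the one of [P t 1], which is at most
    [P t 1 0 + x] on the unit interval. *)
Lemma transition_tail t k j (x : R) : 0 <= t -> 0 <= x <= 1 ->
  P t k j * x ^+ j <= (P t 1%N 0%N + x) ^+ k.
Proof.
move=> t0 /andP[x0 x1]; have p0 : 0 <= P t 1%N 0%N + x.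
  by rewrite addr_ge0 ?transition_ge0.
elim: k j => [|k IH] j.
  by rewrite absorbing0 // expr0; case: eqP => [->|]; rewrite ?mul0r ?expr0 ?mulr1.
rewrite -add1n hB // exprD expr1 mulr_suml.
apply: (@le_trans _ _ (\sum_(i < j.+1) (P t 1%N i * x ^+ i) * (P t 1%N 0%N + x) ^+ k)).
  apply: ler_sum => i _.
  have -> : x ^+ j = x ^+ i * x ^+ (j - i) by rewrite -exprD subnKC // -ltnS.
  rewrite mulrACA ler_wpM2l //.
  by rewrite mulr_ge0 ?transition_ge0 ?exprn_ge0.
rewrite -mulr_suml ler_wpM2r ?exprn_ge0 // big_ord_recl expr0 mulr1 lerD2l.
apply: (@le_trans _ _ (x * \sum_(i < j) P t 1%N i.+1)).
  rewrite mulr_sumr; apply: ler_sum => i _.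
  rewrite lift0 mulrC exprS -mulrA ler_wpM2l // ler_piMl ?transition_ge0 //.
  exact: exprn_ile1.
rewrite ler_piMr //; apply: le_trans (pmf_sum_le1 j.+1 (semigroup_pmf hP 1%N t0)).
by rewrite [leRHS]big_ord_recl ler_wpDl ?transition_ge0.
Qed.

Definition survival t := 1 - P t 1%N 0%N.

(** By independence, [k] individuals alive at time [s] all have no descendants at time
    [s + t] with probability [(1 - survival t) ^ k]. *)
Lemma cvg_survivalD s t : 0 <= s -> 0 <= t ->
  series (fun k => P s 1%N k * (1 - (1 - survival t) ^+ k)) @ \oo -->
  survival (s + t).
Proof.
move=> s0 t0; rewrite {2}/survival.
have [_ c1] := semigroup_pmf hP 1%N s0.
have c2 := @chapman_kolmogorov _ _ hP s t 1%N 0%N s0 t0.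
rewrite (_ : series _ =
    series (P s 1%N) - series (fun k => P s 1%N k * P t k 0%N)).
  exact: cvgB c1 c2.
apply/funext => n; rewrite !fctE /series /= -sumrB; apply: eq_bigr => k _.
by rewrite extinctionX // /survival subKr mulrBr mulr1.
Qed.

Variable m : R.
Hypothesis hE : forall t : R, 0 <= t ->
  series (fun k => k%:R * P t 1%N k) @ \oo --> expR (- m * t).

Lemma sum_mean_le t n : 0 <= t ->
  \sum_(k < n) k%:R * P t 1%N k <= expR (- m * t).
Proof.
move=> t0; apply: sum_le_cvg_series (hE t0) => k.
by rewrite mulr_ge0 ?transition_ge0.
Qed.

Lemma survival_ge0 t : 0 <= t -> 0 <= survival t <= 1.
Proof.
move=> t0; rewrite subr_ge0 gerBl transition_ge0 // andbT.
exact: pmf_le1 (semigroup_pmf hP 1%N t0).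
Qed.

Lemma survival_gt0 t : 0 <= t -> 0 < survival t.
Proof.
move=> t0; have /andP[s0 _] := survival_ge0 t0.
rewrite lt_def s0 andbT subr_eq0 eq_sym; apply/eqP => q1.
have := hE t0; have hp := pmf_point _ (semigroup_pmf hP 1%N t0) q1.
rewrite (_ : (fun k => _) = fun=> 0); last first.
  by apply/funext => -[|k]; rewrite ?mul0r // hp mulr0.
move/(cvg_series_finite (N := 0)); rewrite big_ord0 => /(_ (fun _ _ => erefl)) /eqP.
by rewrite eq_sym expR_eq0.
Qed.

Lemma survival_le t : 0 <= t -> survival t <= expR (- m * t).
Proof.
move=> t0; have [_ c1] := semigroup_pmf hP 1%N t0.
rewrite lerBlDr; apply: cvg_series_le c1 => -[|n].
  by rewrite big_ord0 addr_ge0 ?expR_ge0 ?transition_ge0.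
rewrite big_ord_recl addrC lerD2r; apply: le_trans (sum_mean_le n.+1 t0).
rewrite big_ord_recl mul0r add0r; apply: ler_sum => i _.
by rewrite lift0 ler_peMl ?ler1n // transition_ge0.
Qed.

Hypothesis m_gt0 : 0 < m.

Lemma cvg_survival : survival t @[t --> +oo] --> 0.
Proof.
apply: (@squeeze_cvgr _ _ _ _ (fun=> 0) (fun t => expR (- (m * t)))).
- near=> t; have t0 : 0 <= t by near: t; exact: nbhs_pinfty_ge.
  by case/andP: (survival_ge0 t0) => -> _ /=; rewrite -mulNr survival_le.
- exact: cvg_cst.
- have my : m * t @[t --> +oo] --> +oo by apply: gt0_cvgMry => //; exact: cvg_id.
  exact: (cvg_comp _ _ my (@cvgr_expR R)).
Unshelve. all: by end_near. Qed.

(** The function [x |-> E_1 (1 - (1 - x) ^ Z_s)] has derivative [E_1 Z_s] at 0; the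
    lower bound goes through a truncation of this expectation, since [Z_s] may have no
    second moment. *)
Lemma cvg_survival_ratio s : 0 <= s ->
  survival (s + t) / survival t @[t --> +oo] --> expR (- m * s).
Proof.
move=> s0; apply/cvgrPdist_le => e e0.
have e20 : 0 < e / 2 by rewrite divr_gt0.
have [N HN] : exists N, expR (- m * s) - e / 2 <= \sum_(k < N) k%:R * P s 1%N k.
  have /cvgr_ge/(_ (expR (- m * s) - e / 2)) := hE s0.
  rewrite gtrBl => /(_ e20) [N _ /(_ N (leqnn N)) /= HN].
  by exists N; rewrite /series /= big_mkord in HN.
pose B := \sum_(k < N) k%:R ^+ 2 * P s 1%N k.
have B0 : 0 <= B.
  by rewrite sumr_ge0 // => k _; rewrite mulr_ge0 ?sqr_ge0 ?transition_ge0.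
near=> t.
have t0 : 0 <= t by near: t; exact: nbhs_pinfty_ge.
have x0 := survival_gt0 t0; have /andP[_ x1] := survival_ge0 t0.
have xe : survival t < e / 2 / (B + 1).
  by near: t; apply: (cvgr_lt _ cvg_survival); rewrite divr_gt0 // ltr_wpDl.
set x := survival t in x0 x1 xe *.
have x01 : 0 <= x <= 1 by rewrite ltW.
have up : survival (s + t) <= expR (- m * s) * x.
  apply: cvg_series_le (cvg_survivalD s0 t0) => n.
  apply: (@le_trans _ _ (\sum_(k < n) (k%:R * P s 1%N k) * x)).
    apply: ler_sum => k _; rewrite mulrAC mulrC ler_wpM2r ?transition_ge0 //.
    by have := expr1B_ge k x01; rewrite -/x; lra.
  by rewrite -mulr_suml ler_wpM2r ?sum_mean_le // ltW.
have lo : ((\sum_(k < N) k%:R * P s 1%N k) - x * B) * x <= survival (s + t).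
  apply: le_trans (sum_le_cvg_series N _ (cvg_survivalD s0 t0)); last first.
    move=> k; rewrite mulr_ge0 ?transition_ge0 // -/x subr_ge0 exprn_ile1 //.
      by rewrite subr_ge0.
    by rewrite gerBl ltW.
  rewrite mulrBl mulrAC -expr2 mulr_suml mulr_sumr -sumrB; apply: ler_sum => k _.
  rewrite -/x (_ : _ - _ = P s 1%N k * (k%:R * x - k%:R ^+ 2 * x ^+ 2)); last by ring.
  rewrite ler_wpM2l ?transition_ge0 //.
  by have := expr1B_le k x01; lra.
have xB : x * B <= e / 2.
  apply: (@le_trans _ _ (x * (B + 1))); first by rewrite ler_pM2l // lerDl.
  by rewrite -ler_pdivlMr ?ltW // ltr_wpDl.
rewrite -ler_pdivlMr // in lo *; rewrite -ler_pdivrMr // in up.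
by rewrite ler_norml; apply/andP; split; lra.
Unshelve. all: by end_near. Qed.

Variable h : nat -> R.
Hypothesis h00 : h 0%N = 0.
Hypothesis h_ge0 : forall k, 0 <= h k.
Hypothesis h_le1 : forall n, \sum_(k < n) h k <= 1.
Hypothesis hY : forall (g : nat -> R) (V : R -> R),
  (forall k, 0 <= g k <= 1) -> g 0%N = 0 ->
  (forall t : R, 0 <= t -> series (fun k => g k * P t 1%N k) @ \oo --> V t) ->
  exists2 I : R, series (fun k => g k * h k) @ \oo --> I &
             V t / survival t @[t --> +oo] --> I.

Lemma cvg_yaglom_mass j : (0 < j)%N ->
  P t 1%N j / survival t @[t --> +oo] --> h j.
Proof.
move=> j0; pose g k : R := (k == j)%:R.
have gE f : series (fun k => g k * f k) @ \oo --> (f j : R).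
  apply/(cvg_series_finite (N := j.+1)) => [i ji|]; first by rewrite /g gtn_eqF ?mul0r.
  rewrite big_ord_recr /= /g eqxx mul1r big1 ?add0r // => i _.
  by rewrite ltn_eqF ?mul0r.
have [||t _|I cI] := hY (g := g) (V := fun t => P t 1%N j).
- by move=> k; rewrite /g; case: eqP; rewrite ?lexx ?ler01.
- by rewrite /g eq_sym gtn_eqF.
- exact: gE.
by rewrite (cvg_unique _ cI (gE h)).
Qed.

(** Chapman-Kolmogorov at time [t + s], divided by [survival t], passes to the limit
    because [P s k j] is a bounded function of [k].  The mass lost from the positive
    integers goes to 0, whence the last summand. *)
Lemma yaglom_quasistationary s j : 0 <= s ->
  series (fun k => h k * P s k j) @ \oo -->
  expR (- m * s) * h j + (j == 0)%:R * (1 - expR (- m * s)).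
Proof.
move=> s0; pose g k := if k == 0%N then 0 else P s k j.
have [|//|t t0|I cI cV] := hY (g := g)
  (V := fun t => P (t + s) 1%N j - P t 1%N 0%N * P s 0%N j).
- rewrite /g => -[|k] /=; first by rewrite lexx ler01.
  by rewrite transition_ge0 // pmf_le1 //; exact: semigroup_pmf.
- have c2 := @chapman_kolmogorov _ _ hP t s 1%N j t0 s0.
  have c3 : series (fun k => (k == 0)%:R * (P t 1%N k * P s k j)) @ \oo -->
      P t 1%N 0%N * P s 0%N j.
    apply/(cvg_series_finite (N := 1)) => [[//|i _]|]; first by rewrite mul0r.
    by rewrite big_ord1 mul1r.
  rewrite (_ : series _ = series (fun k => P t 1%N k * P s k j) -
      series (fun k => (k == 0)%:R * (P t 1%N k * P s k j))).
    exact: cvgB c2 c3.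
  apply/funext => n; rewrite !fctE /series /= -sumrB; apply: eq_bigr => k _.
  by rewrite /g; case: eqP => _; rewrite ?mul0r ?mul1r ?subr0 ?subrr // mulrC.
rewrite (_ : (fun k => h k * P s k j) = fun k => g k * h k); last first.
  by apply/funext => k; rewrite /g; case: eqP => [->|_]; rewrite ?h00 ?mul0r // mulrC.
suff cV' : (P (t + s) 1%N j - P t 1%N 0%N * P s 0%N j) / survival t @[t --> +oo] -->
    expR (- m * s) * h j + (j == 0)%:R * (1 - expR (- m * s)).
  by rewrite -(cvg_unique _ cV cV').
have [->|j0] := posnP j.
  rewrite h00 mulr0 add0r mul1r.
  have c : 1 - survival (s + t) / survival t @[t --> +oo] --> 1 - expR (- m * s).
    by apply: cvgB; [exact: cvg_cst|exact: cvg_survival_ratio].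
  apply: cvg_near_eq c; near=> t.
  have t0 : 0 <= t by near: t; exact: nbhs_pinfty_ge.
  have x0 := survival_gt0 t0.
  rewrite h0 // mulr1 -[X in X - _](divff (lt0r_neq0 x0)) -mulrBl [t + s]addrC.
  by congr (_ / _); rewrite /survival; ring.
rewrite mul0r addr0 mulrC.
have cts : t + s @[t --> +oo] --> +oo.
  apply/cvgryPge => A; near=> t; rewrite -lerBlDr; near: t.
  by apply: nbhs_pinfty_ge; exact: num_real.
have c1 := cvg_comp _ _ cts (cvg_yaglom_mass j0).
apply: cvg_near_eq (cvgM c1 (cvg_survival_ratio s0)); near=> t.
have t0 : 0 <= t by near: t; exact: nbhs_pinfty_ge.
have ts0 : 0 <= t + s by rewrite addr_ge0.
rewrite !fctE /= absorbing0 // gtn_eqF // mulr0 subr0 [s + t]addrC mulrA mulfVK //.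
by rewrite gt_eqF // survival_gt0.
Unshelve. all: by end_near. Qed.

Lemma cvg_expR_slope : s^-1 * (1 - expR (- m * s)) @[s --> (0 : R)^'+] --> m.
Proof.
apply: (@squeeze_cvgr _ _ _ _ (fun s => m - m ^+ 2 * s) (fun=> m)).
- near=> s; have s0 : 0 < s by near: s; exact: nbhs_right_gt.
  rewrite [s^-1 * _]mulrC ler_pdivlMr // ler_pdivrMr //.
  have ms0 : 0 < m * s by rewrite mulr_gt0.
  have e1 := expR_ge1Dx (- m * s); have e2 := expR_ge1Dx (m * s).
  have e3 : expR (- m * s) * expR (m * s) = 1 by rewrite mulNr mulrC expRxMexpNx_1.
  have e4 : expR (- m * s) * (1 + m * s) <= 1.
    by rewrite -[leRHS]e3 ler_wpM2l ?expR_ge0.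
  apply/andP; split; last by lra.
  rewrite [leLHS](_ : _ = (m * s) * (1 - m * s)); last by ring.
  have : 0 <= (m * s) * ((m * s) * (m * s)) by rewrite !mulr_ge0 // ltW.
  move: e4 ms0; set x := m * s; set e := expR _ => e4 x0 x3.
  rewrite -(ler_pM2r (_ : 0 < 1 + x)); last by rewrite addr_gt0.
  by lra.
- rewrite -[X in _ --> X](_ : m - m ^+ 2 * 0 = m); last by rewrite mulr0 subr0.
  apply: cvg_at_right_filter; apply: cvgB; first exact: cvg_cst.
  by apply: cvgMl_tmp; exact: cvg_id.
- exact: cvg_cst.
Unshelve. all: by end_near. Qed.

(** Right derivative at [s = 0] of [yaglom_quasistationary].  Going down by at least
    two takes two deaths: by [transition_tail] with [x = s], the terms [k > n + 1] of the
    series are of order [s ^ 2], and the derivative only acts on a finite sum. *)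
Lemma yaglom_generator (r : R) (p : nat -> R) :
  is_infinitesimal_generator (bgw_generator r p) P -> forall n,
  conv (fderiv h) (drift r p) n = m * ((n == 0)%:R - h n).
Proof.
move=> hL n; rewrite -sum_bgw_generator.
pose V s := expR (- m * s) * h n + (n == 0)%:R * (1 - expR (- m * s)).
pose head s := \sum_(k < n.+2) h k * P s k n.
(* [P s 1 0 + s <= C * s] for small [s] *)
pose C : R := `|bgw_generator r p 1 0| + 2.
have C0 : 0 <= C by rewrite addr_ge0.
have C1 : 0 < C + 1 by rewrite ltr_wpDl.
have cvhead : s^-1 * (head s - h n) @[s --> (0 : R)^'+] -->
    \sum_(k < n.+2) h k * bgw_generator r p k n.
  rewrite (_ : (fun s => _) =
      fun s => \sum_(k < n.+2) h k * (s^-1 * (P s k n - (nat_of_ord k == n)%:R))).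
    by apply: (cvg_big add_continuous) => k _; apply: cvgMl_tmp; exact: hL.
  apply/funext => s.
  rewrite (_ : h n = \sum_(k < n.+2) h k * (nat_of_ord k == n)%:R); last first.
    have n2 : (n < n.+2)%N by [].
    rewrite (bigD1 (Ordinal n2)) //= eqxx mulr1 big1 ?addr0 // => i /negPf ni.
    by rewrite (_ : (nat_of_ord i == n) = false) ?mulr0.
  rewrite /head -sumrB mulr_sumr; apply: eq_bigr => k _.
  by rewrite -mulrBr mulrCA.
have cvV : s^-1 * (V s - h n) @[s --> (0 : R)^'+] --> m * ((n == 0)%:R - h n).
  rewrite (_ : (fun s => _) =
      fun s => s^-1 * (1 - expR (- m * s)) * ((n == 0)%:R - h n)).
    by apply: cvgMr_tmp; exact: cvg_expR_slope.
  by apply/funext => s; rewrite /V; ring.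
have cvtail : s^-1 * (V s - head s) @[s --> (0 : R)^'+] --> 0.
  apply: (@squeeze_cvgr _ _ _ _ (fun=> 0) (fun s => C ^+ n.+2 * s)); last first.
  - rewrite -[X in _ --> X](mulr0 (C ^+ n.+2)).
    by apply: cvg_at_right_filter; apply: cvgMl_tmp; exact: cvg_id.
  - exact: cvg_cst.
  near=> s; have s0 : 0 < s by near: s; exact: nbhs_right_gt.
  have f0 k : 0 <= h k * P s k n by rewrite mulr_ge0 ?transition_ge0 // ltW.
  have cV := yaglom_quasistationary (j := n) (ltW s0).
  have P10 : P s 1%N 0%N <= (C - 1) * s.
    rewrite mulrC -ler_pdivrMl //; near: s.
    have /cvgr_le/(_ (C - 1)) := hL 1%N 0%N; rewrite /C.
    have gC : bgw_generator r p 1 0 < `|bgw_generator r p 1 0| + 2 - 1.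
      by have := ler_norm (bgw_generator r p 1 0); lra.
    by move/(_ gC); apply: filterS => s /=; rewrite subr0.
  have P10' : P s 1%N 0%N + s <= C * s by lra.
  have Cs0 : 0 <= C * s.
    by apply: le_trans P10'; rewrite addr_ge0 ?transition_ge0 // ltW.
  have Cs1 : C * s <= 1.
    apply: (@le_trans _ _ ((C + 1) * s)); first by rewrite ler_pM2r // lerDl.
    rewrite mulrC -ler_pdivlMr //; near: s; apply: nbhs_right_le.
    by rewrite divr_gt0.
  have s1 : s <= 1 by near: s; exact: nbhs_right_le.
  have tail i : P s (n.+2 + i)%N n <= C ^+ n.+2 * s ^+ 2.
    rewrite -(ler_pM2r (exprn_gt0 n s0)).
    apply: le_trans (transition_tail _ _ (ltW s0) _) _; first by rewrite ltW.
    apply: (@le_trans _ _ ((C * s) ^+ (n.+2 + i))).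
      by rewrite lerXn2r // nnegrE addr_ge0 ?transition_ge0 // ltW.
    rewrite exprD; apply: (@le_trans _ _ ((C * s) ^+ n.+2)).
      by rewrite ler_piMr ?exprn_ge0 // exprn_ile1.
    by rewrite exprMn [s ^+ n.+2]exprS [s ^+ n.+1]exprS expr2 !mulrA.
  rewrite [s^-1 * _]mulrC ler_pdivlMr // mul0r ler_pdivrMr // subr_ge0 lerBlDl.
  apply/andP; split; first exact: sum_le_cvg_series cV.
  apply: cvg_series_le cV => N.
  apply: (@le_trans _ _ (\sum_(k < n.+2 + N) h k * P s k n)).
    by rewrite addnC big_split_ord /= lerDl sumr_ge0.
  rewrite big_split_ord /= lerD2l -mulrA -expr2.
  apply: (@le_trans _ _ (\sum_(i < N) h (n.+2 + i)%N * (C ^+ n.+2 * s ^+ 2))).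
    by apply: ler_sum => i _; rewrite ler_wpM2l.
  have B0 : 0 <= C ^+ n.+2 * s ^+ 2.
    by apply: mulr_ge0; [exact: exprn_ge0|exact: sqr_ge0].
  rewrite -mulr_suml (ler_piMl B0) //.
  apply: le_trans (h_le1 (n.+2 + N)).
  by rewrite big_split_ord /= lerDr sumr_ge0.
have cvhead' : s^-1 * (head s - h n) @[s --> (0 : R)^'+] --> m * ((n == 0)%:R - h n).
  rewrite -[X in _ --> X]subr0 (_ : (fun s => _) =
    fun s => s^-1 * (V s - h n) - s^-1 * (V s - head s)); first exact: cvgB.
  by apply/funext => s; ring.
exact: (cvg_unique _ cvhead cvhead').
Unshelve. all: by end_near. Qed.

End Branching.

(** * Complex sequences and functions *)

Section ComplexSequences.
Variable R : realType.
Implicit Types (z w : R[i]) (x y : R).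
Local Notation Re := (@complex.Re R).
Local Notation Im := (@complex.Im R).
Local Notation normc := (@Normc.normc R).

Lemma complexP z w : Re z = Re w -> Im z = Im w -> z = w.
Proof. by move: z w => [a b] [c e] /= -> ->. Qed.

Lemma ReD z w : Re (z + w) = Re z + Re w.
Proof. by move: z w => [a b] [c e]. Qed.

Lemma ImD z w : Im (z + w) = Im z + Im w.
Proof. by move: z w => [a b] [c e]. Qed.

Lemma ReN z : Re (- z) = - Re z. Proof. by case: z. Qed.
Lemma ImN z : Im (- z) = - Im z. Proof. by case: z. Qed.

Lemma ReM z w : Re (z * w) = Re z * Re w - Im z * Im w.
Proof. by move: z w => [a b] [c e]. Qed.

Lemma ImM z w : Im (z * w) = Re z * Im w + Im z * Re w.
Proof. by move: z w => [a b] [c e]. Qed.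

Lemma ReZ x z : Re (x%:C * z) = x * Re z.
Proof. by rewrite ReM /= mul0r subr0. Qed.

Lemma ImZ x z : Im (x%:C * z) = x * Im z.
Proof. by rewrite ImM /= mul0r addr0. Qed.

Lemma Re_sum (I : Type) (s : seq I) (P : pred I) (F : I -> R[i]) :
  Re (\sum_(i <- s | P i) F i) = \sum_(i <- s | P i) Re (F i).
Proof. by apply: (big_morph Re ReD). Qed.

Lemma Im_sum (I : Type) (s : seq I) (P : pred I) (F : I -> R[i]) :
  Im (\sum_(i <- s | P i) F i) = \sum_(i <- s | P i) Im (F i).
Proof. by apply: (big_morph Im ImD). Qed.

Lemma normcE z : `|z| = (normc z)%:C.
Proof. by case: z. Qed.

Lemma normc_ge0 z : 0 <= normc z.
Proof. by case: z => a b; rewrite sqrtr_ge0. Qed.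

Lemma normc_real x : normc x%:C = `|x|.
Proof. by rewrite /= expr0n /= addr0 sqrtr_sqr. Qed.

Lemma normcX z n : normc (z ^+ n) = normc z ^+ n.
Proof.
elim: n => [|n IH]; first by rewrite !expr0 Normc.normc1.
by rewrite !exprS Normc.normcM IH.
Qed.

Lemma Re_le_normc z : `|Re z| <= normc z.
Proof.
case: z => a b /=; rewrite -sqrtr_sqr ler_sqrt ?lerDl ?sqr_ge0 //.
by rewrite addr_ge0 ?sqr_ge0.
Qed.

Lemma Im_le_normc z : `|Im z| <= normc z.
Proof.
case: z => a b /=; rewrite -sqrtr_sqr ler_sqrt ?lerDr ?sqr_ge0 //.
by rewrite addr_ge0 ?sqr_ge0.
Qed.

Lemma normc_le_ReIm z : normc z <= `|Re z| + `|Im z|.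
Proof.
case: z => a b /=; rewrite -[leRHS]ger0_norm ?addr_ge0 // -sqrtr_sqr.
rewrite ler_sqrt ?sqr_ge0 // sqrrD !real_normK ?num_real //.
by rewrite -addrA lerD2l lerDr mulrn_wge0 // mulr_ge0.
Qed.

Lemma normc_sum (I : Type) (s : seq I) (P : pred I) (F : I -> R[i]) :
  normc (\sum_(i <- s | P i) F i) <= \sum_(i <- s | P i) normc (F i).
Proof.
elim/big_rec2: _ => [|i y z _ le_zy]; first by rewrite Normc.normc0.
by apply: le_trans (le_normcD _ _) _; rewrite lerD2l.
Qed.

Lemma normcB z w : normc (z - w) = normc (w - z).
Proof. by rewrite -normcN opprB. Qed.

Lemma cvg_normcP (u : nat -> R[i]) (l : R[i]) :
  u @ \oo --> (l : R[i]^o) <-> normc (l - u n) @[n --> \oo] --> 0.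
Proof.
have E := @cvgrPdist_lt R[i] R[i]^o nat \oo _ u l.
split=> [/E h|/cvgrPdist_lt h].
  apply/cvgrPdist_lt => e e0; have := h e%:C; rewrite (ltcR 0 e) => /(_ e0).
  by apply: filterS => n; rewrite normcE ltcR sub0r normrN ger0_norm ?normc_ge0.
apply/E => e; case: e => e e'; rewrite ltcE /= => /andP[/eqP -> e0].
apply: filterS (h e e0) => n; rewrite sub0r normrN ger0_norm ?normc_ge0 //.
by rewrite normcE ltcR.
Qed.

Lemma cvg_complexP (u : nat -> R[i]) (l : R[i]) :
  u @ \oo --> (l : R[i]^o) <->
  (Re (u n) @[n --> \oo] --> Re l /\ Im (u n) @[n --> \oo] --> Im l).
Proof.
rewrite cvg_normcP; split=> [/cvgrPdist_lt h|[/cvgrPdist_lt hr /cvgrPdist_lt hi]].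
  split; apply/cvgrPdist_lt => e /h; apply: filterS => n;
    rewrite sub0r normrN ger0_norm ?normc_ge0 //; apply: le_lt_trans.
  - by rewrite -ReN -ReD Re_le_normc.
  - by rewrite -ImN -ImD Im_le_normc.
apply/cvgrPdist_lt => e e0; have e2 : 0 < e / 2 by rewrite divr_gt0.
near=> n; rewrite sub0r normrN ger0_norm ?normc_ge0 //.
apply: le_lt_trans (normc_le_ReIm _) _; rewrite [e]splitr ReD ImD ReN ImN.
by apply: ltrD; near: n; [exact: hr|exact: hi].
Unshelve. all: by end_near. Qed.

End ComplexSequences.

Section ComplexFunctions.
Variable R : realType.
Implicit Types (z w : R[i]) (x y a : R).
Local Notation Re := (@complex.Re R).
Local Notation Im := (@complex.Im R).
Local Notation normc := (@Normc.normc R).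

Lemma cexpD z w : cexp (z + w) = cexp z * cexp w.
Proof.
by apply: complexP; rewrite /cexp !(ReM, ImM, ReZ, ImZ) ReD ImD expRD /= cosD sinD;
  ring.
Qed.

Lemma cexp0 : cexp 0 = 1 :> R[i].
Proof. by apply: complexP; rewrite /cexp ?ReZ ?ImZ /= expR0 ?cos0 ?sin0 mul1r. Qed.

Lemma normc_cexp z : normc (cexp z) = expR (Re z).
Proof.
rewrite /cexp Normc.normcM normc_real ger0_norm ?expR_ge0 //=.
by rewrite cos2Dsin2 sqrtr1 mulr1.
Qed.

Lemma cpowD w a b : cpow w (a + b) = cpow w a * cpow w b.
Proof. by rewrite /cpow rmorphD mulrDl cexpD. Qed.

Lemma cpow0 w : cpow w 0 = 1.
Proof. by rewrite /cpow mul0r cexp0. Qed.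

Lemma cpow1 a : cpow (1 : R[i]) a = 1.
Proof.
rewrite /cpow /clog normr1 /= ln1 mul0r atan0.
by rewrite (_ : _ * _ = 0) ?cexp0 // mulr0.
Qed.

Lemma normc_cpow w a : normc (cpow w a) = expR (a * ln (normc w)).
Proof. by rewrite /cpow normc_cexp ReZ /clog normcE. Qed.

Lemma clogE w : 0 < Re w ->
  clog w = (ln (Re w ^+ 2 + Im w ^+ 2) / 2) +i* atan (Im w / Re w).
Proof.
case: w => u v /= u0; rewrite /clog normcE /=; congr (_ +i* _).
have uv0 : 0 < u ^+ 2 + v ^+ 2 by rewrite ltr_wpDr ?sqr_ge0 // exprn_gt0.
rewrite -powR12_sqrt ?ltW // ln_powR mulrC //.
Qed.

(** The principal logarithm is continuous in the right half-plane. *)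
Lemma cvg_cpow (u : nat -> R[i]) w a : 0 < Re w ->
  u @ \oo --> (w : R[i]^o) ->
  cpow (u n) a @[n --> \oo] --> (cpow w a : R[i]^o).
Proof.
move=> w0 /cvg_complexP[ur ui]; apply/cvg_complexP.
have w20 : 0 < Re w ^+ 2 + Im w ^+ 2 by rewrite ltr_wpDr ?sqr_ge0 // exprn_gt0.
have cvgc (f : R -> R) (v : nat -> R) l : {for l, continuous f} ->
    v @ \oo --> l -> f (v n) @[n --> \oo] --> f l.
  by move=> cf cv; exact: continuous_cvg.
pose L n := ln (Re (u n) ^+ 2 + Im (u n) ^+ 2) / 2.
pose A n := atan (Im (u n) / Re (u n)).
have cL : L n @[n --> \oo] --> ln (Re w ^+ 2 + Im w ^+ 2) / 2.
  apply: cvgMr_tmp; apply: (cvgc (@ln R)); first exact: continuous_ln.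
  by rewrite !expr2; apply: cvgD; apply: cvgM.
have cA : A n @[n --> \oo] --> atan (Im w / Re w).
  apply: (cvgc (@atan R)); first exact: continuous_atan.
  by apply: cvgM => //; apply: cvgV => //; rewrite gt_eqF.
have uE : \forall n \near \oo, cpow (u n) a = cexp (a * L n +i* (a * A n)).
  near=> n; rewrite /cpow clogE; last by near: n; exact: (cvgr_gt _ ur).
  by congr cexp; apply: complexP; rewrite ?ReZ ?ImZ.
have wE : cpow w a = cexp ((a * (ln (Re w ^+ 2 + Im w ^+ 2) / 2))
    +i* (a * atan (Im w / Re w))).
  by rewrite /cpow clogE //; congr cexp; apply: complexP; rewrite ?ReZ ?ImZ.
have cE : expR (a * L n) @[n --> \oo] --> expR (a * (ln (Re w ^+ 2 + Im w ^+ 2) / 2)).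
  by apply: (cvgc (@expR R)); [exact: continuous_expR|exact: cvgMl_tmp].
rewrite wE; split.
  apply: (@cvg_near_eq R _ _ _ (fun n => expR (a * L n) * cos (a * A n))).
    by apply: filterS uE => n ->; rewrite /cexp ReZ.
  rewrite /cexp ReZ /=; apply: cvgM cE _.
  by apply: (cvgc (@cos R)); [exact: continuous_cos|exact: cvgMl_tmp].
apply: (@cvg_near_eq R _ _ _ (fun n => expR (a * L n) * sin (a * A n))).
  by apply: filterS uE => n ->; rewrite /cexp ImZ.
rewrite /cexp ImZ /=; apply: cvgM cE _.
by apply: (cvgc (@sin R)); [exact: continuous_sin|exact: cvgMl_tmp].
Unshelve. all: by end_near. Qed.

End ComplexFunctions.

(** * Derivatives of complex-valued functions of a real variable *)

Section ComplexDerivative.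
Variable R : realType.
Implicit Types (z w : R[i]) (t x a : R) (f g : R -> R[i]).
Local Notation Re := (@complex.Re R).
Local Notation Im := (@complex.Im R).
Local Notation normc := (@Normc.normc R).

Definition is_cderive t f (df : R[i]) :=
  is_derive t 1 (fun x => Re (f x)) (Re df) /\
  is_derive t 1 (fun x => Im (f x)) (Im df).

Lemma is_cderive_eq t f (df df' : R[i]) :
  is_cderive t f df -> df = df' -> is_cderive t f df'.
Proof. by move=> ? <-. Qed.

Lemma is_cderiveM t f g (df dg : R[i]) : is_cderive t f df -> is_cderive t g dg ->
  is_cderive t (fun x => f x * g x) (df * g t + f t * dg).
Proof.
move=> [fr fi] [gr gi]; split.
  rewrite (_ : (fun x => _) = (fun x => Re (f x)) * (fun x => Re (g x)) -
      (fun x => Im (f x)) * (fun x => Im (g x))).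
    apply: is_derive_eq (is_deriveB (is_deriveM fr gr) (is_deriveM fi gi)) _.
    by rewrite ReD !ReM /GRing.scale /=; ring.
  by apply/funext => x; rewrite ReM.
rewrite (_ : (fun x => _) = (fun x => Re (f x)) * (fun x => Im (g x)) +
    (fun x => Im (f x)) * (fun x => Re (g x))).
  apply: is_derive_eq (is_deriveD (is_deriveM fr gi) (is_deriveM fi gr)) _.
  by rewrite ImD !ImM /GRing.scale /=; ring.
by apply/funext => x; rewrite ImM.
Qed.

Lemma is_cderive_cst t z : is_cderive t (fun=> z) 0.
Proof. by split; exact: is_derive_cst. Qed.

Lemma is_cderiveZ t z f (df : R[i]) : is_cderive t f df ->
  is_cderive t (fun x => z * f x) (z * df).
Proof.
move=> fd; apply: is_cderive_eq (is_cderiveM (is_cderive_cst t z) fd) _.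
by rewrite mul0r add0r.
Qed.

Lemma is_cderiveB t f g (df dg : R[i]) : is_cderive t f df -> is_cderive t g dg ->
  is_cderive t (fun x => f x - g x) (df - dg).
Proof.
move=> [fr fi] [gr gi]; split.
  rewrite (_ : (fun x => _) = (fun x => Re (f x)) - (fun x => Re (g x))).
    by apply: is_derive_eq; rewrite ReD ReN.
  by apply/funext => x; rewrite ReD ReN.
rewrite (_ : (fun x => _) = (fun x => Im (f x)) - (fun x => Im (g x))).
  by apply: is_derive_eq; rewrite ImD ImN.
by apply/funext => x; rewrite ImD ImN.
Qed.

Lemma is_cderive_real t : is_cderive t (fun x => x%:C) 1.
Proof. by split; [exact: is_derive_id|exact: is_derive_cst]. Qed.

Lemma is_cderive_poly t (q : {poly R[i]}) :
  is_cderive t (fun x => q.[x%:C]) (q^`()).[t%:C].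
Proof.
elim/poly_ind: q => [|q c IH].
  rewrite derivC hornerC (_ : (fun x => _) = fun=> 0); first exact: is_cderive_cst.
  by apply/funext => x; rewrite hornerC.
rewrite (_ : (fun x => _) = fun x => q.[x%:C] * x%:C - (fun=> - c) x).
  apply: is_cderive_eq (is_cderiveB (is_cderiveM IH (is_cderive_real t))
    (is_cderive_cst t (- c))) _.
  by rewrite subr0 derivMXaddC hornerD hornerMX mulr1 addrC.
by apply/funext => x; rewrite hornerMXaddC opprK.
Qed.

Lemma is_cderive_exp t f (df : R[i]) : is_cderive t f df ->
  is_cderive t (fun x => cexp (f x)) (df * cexp (f t)).
Proof.
move=> [fr fi].
have er : is_derive t 1 (fun x => expR (Re (f x))) (expR (Re (f t)) * Re df).
  by apply: is_derive_eq; rewrite /GRing.scale /= mulrC.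
have ci : is_derive t 1 (fun x => cos (Im (f x))) (- sin (Im (f t)) * Im df).
  by apply: is_derive_eq; rewrite /GRing.scale /= mulrC.
have si : is_derive t 1 (fun x => sin (Im (f x))) (cos (Im (f t)) * Im df).
  by apply: is_derive_eq; rewrite /GRing.scale /= mulrC.
split.
  rewrite (_ : (fun x => _) = (fun x => expR (Re (f x))) * (fun x => cos (Im (f x)))).
    by apply: is_derive_eq; rewrite ReM /cexp ReZ ImZ /GRing.scale /=; ring.
  by apply/funext => x; rewrite /cexp ReZ.
rewrite (_ : (fun x => _) = (fun x => expR (Re (f x))) * (fun x => sin (Im (f x)))).
  by apply: is_derive_eq; rewrite ImM /cexp ReZ ImZ /GRing.scale /=; ring.
by apply/funext => x; rewrite /cexp ImZ.
Qed.

Lemma is_cderive_log t f (df : R[i]) : 0 < Re (f t) ->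
  is_cderive t f df -> is_cderive t (fun x => clog (f x)) (df / f t).
Proof.
move=> f0 [fr fi].
set u := fun x => Re (f x) in fr; set v := fun x => Im (f x) in fi.
have u0 : u t != 0 by rewrite gt_eqF.
have uv0 : 0 < u t ^+ 2 + v t ^+ 2 by rewrite ltr_wpDr ?sqr_ge0 // exprn_gt0.
have near_t : \forall x \near t, 0 < Re (f x).
  have /differentiable_continuous : differentiable u t.
    by apply/derivable1_diffP; case: fr.
  by move/cvgr_gt; apply.
have dE : df / f t = (u t ^+ 2 + v t ^+ 2)^-1%:C * (df * (u t -i* v t)).
  have fE : f t = u t +i* v t by rewrite /u /v; case: (f t).
  have ft0 : f t != 0.
    apply: contraNneq u0; rewrite /u => ->; exact: eqxx.
  apply: (mulIf ft0); rewrite divfK // -mulrA -mulrA fE.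
  rewrite (_ : (u t -i* v t) * _ = (u t ^+ 2 + v t ^+ 2)%:C).
    by rewrite mulrCA -rmorphM mulVf ?mulr1 // gt_eqF.
  by apply: complexP; rewrite ?ReM ?ImM /=; ring.
rewrite {}dE.
have ln_d : is_derive t 1 (fun x => ln (u x ^+ 2 + v x ^+ 2))
    ((u t ^+ 2 + v t ^+ 2)^-1 * (2 * u t * Re df + 2 * v t * Im df)).
  have s_d : is_derive t 1 (fun x => u x ^+ 2 + v x ^+ 2) (2 * u t * Re df + 2 * v t * Im df).
    rewrite (_ : (fun x => _) = u * u + v * v); last first.
      by apply/funext => x; rewrite !expr2.
    apply: is_derive_eq (is_deriveD (is_deriveM fr fr) (is_deriveM fi fi)) _.
    by rewrite /GRing.scale /=; ring.
  have l_d := is_derive1_ln uv0.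
  by apply: is_derive_eq; rewrite /GRing.scale /= mulrC.
have at_d : is_derive t 1 (fun x => atan (v x / u x))
    ((1 + (v t / u t) ^+ 2)^-1 * (Im df / u t - v t * Re df / u t ^+ 2)).
  have q_d : is_derive t 1 (fun x => v x / u x) (Im df / u t - v t * Re df / u t ^+ 2).
    have i_d := @is_deriveV R u t (Re df) 1 u0 fr.
    rewrite (_ : (fun x => _) = v * (fun x => (u x)^-1)) //.
    by apply: is_derive_eq; rewrite /GRing.scale /=; field; rewrite u0.
  by apply: is_derive_eq; rewrite /GRing.scale /= mulrC.
split.
  apply: (@near_eq_is_derive _ _ _ (2^-1 *: (fun x => ln (u x ^+ 2 + v x ^+ 2)))).
    by apply: filterS near_t => x fx0; rewrite clogE //= /GRing.scale /= mulrC.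
  apply: is_derive_eq; rewrite ReZ ReM /GRing.scale /=.
  have := lt0r_neq0 uv0; set D := u t ^+ 2 + v t ^+ 2 => D0.
  by field.
apply: (@near_eq_is_derive _ _ _ (fun x => atan (v x / u x))).
  by apply: filterS near_t => x fx0; rewrite clogE.
apply: is_derive_eq; rewrite ImZ ImM /=.
have := uv0; have := u0; set a := u t; set b := v t => a0 /lt0r_neq0 ab0.
have ab1 : 1 + (b / a) ^+ 2 != 0.
  by rewrite gt_eqF // ltr_wpDr ?sqr_ge0.
by field; rewrite a0 /= ab0.
Qed.

(** Mean value inequality; the factor 2 comes from treating real and imaginary parts
    separately. *)
Lemma cderive_bound f (df : R -> R[i]) e :
  (forall t, 0 <= t <= 1 -> is_cderive t f (df t)) ->
  (forall t, 0 <= t <= 1 -> normc (df t) <= e) -> normc (f 1 - f 0) <= 2 * e.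
Proof.
move=> fd fe; apply: le_trans (normc_le_ReIm _) _.
have part (h dh : R -> R) : (forall t, 0 <= t <= 1 -> is_derive t 1 h (dh t)) ->
    (forall t, 0 <= t <= 1 -> `|dh t| <= e) -> `|h 1 - h 0| <= e.
  move=> hd he.
  have [x||c] := @MVT_segment R h dh 0 1 ler01.
  - by rewrite in_itv /= => /andP[x0 x1]; apply: hd; rewrite !ltW.
  - apply: derivable_within_continuous => x; rewrite in_itv /= => /hd.
    by case.
  rewrite in_itv /= subr0 mulr1 => /andP[c0 c1] ->.
  by apply: he; rewrite c0.
rewrite mulr_natl mulr2n ReD ImD ReN ImN; apply: lerD.
  apply: (part (fun x => Re (f x)) (fun x => Re (df x))) => t t01.
    by case: (fd t t01).
  exact: le_trans (Re_le_normc _) (fe t t01).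
apply: (part (fun x => Im (f x)) (fun x => Im (df x))) => t t01.
  by case: (fd t t01).
exact: le_trans (Im_le_normc _) (fe t t01).
Qed.

End ComplexDerivative.

(** * The sum of a negative power *)

Section NegPowerSeries.
Variable R : realType.
Implicit Types (z w : R[i]) (t x : R) (a h : nat -> R).
Local Notation Re := (@complex.Re R).
Local Notation Im := (@complex.Im R).
Local Notation normc := (@Normc.normc R).

Lemma cvg_geometric_bound a (K q : R) : 0 <= q < 1 ->
  (forall n, 0 <= a n <= K * q ^+ n) -> cvgn (series a).
Proof.
move=> /andP[q0 q1] aK.
apply: (@series_le_cvg _ _ (geometric K q)).
- by move=> n; case/andP: (aK n).
- move=> n; rewrite /geometric /=; case/andP: (aK n) => a0; exact: le_trans.
- by move=> n; case/andP: (aK n).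
- by apply: is_cvg_geometric_series; rewrite ger0_norm.
Qed.

(** Termwise derivation does not decrease the radius of convergence. *)
Lemma cvg_series_deriv a x : (forall n, 0 <= a n) ->
  (forall r, 0 <= r < 1 -> exists K, forall n, a n * r ^+ n <= K) ->
  0 <= x < 1 -> cvgn (series (fun n => n%:R * (a n * x ^+ n))).
Proof.
move=> a0 aK /andP[x0 x1].
pose y := (1 + x) / 2.
have y0 : 0 < y by rewrite /y; lra.
have y1 : y < 1 by rewrite /y; lra.
have xy : x < y by rewrite /y; lra.
(* (1 + e) x = y r with y, r < 1, and n <= (1 + e) ^ n / e *)
pose e := (1 - x) / 4.
have e0 : 0 < e by rewrite /e; lra.
pose r := (1 + e) * x / y.
have r0 : 0 <= r by apply: divr_ge0 (ltW y0); apply: mulr_ge0 => //; lra.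
have r1 : r < 1.
  rewrite ltr_pdivrMr // mul1r /e /y.
  have : 0 < (1 - x) * (2 - x) by apply: mulr_gt0; lra.
  by lra.
have yr : y * r = (1 + e) * x by rewrite /r mulrC divfK // gt_eqF.
clearbody r e y.
have [|K hK] := aK y; first by rewrite ltW.
apply: (@cvg_geometric_bound _ (K / e) r) => [|n]; first by rewrite r0.
rewrite !mulr_ge0 ?exprn_ge0 //=.
have ne : n%:R <= (1 + e) ^+ n / e.
  rewrite ler_pdivlMr //; elim: n => [|n IH]; first by rewrite mul0r expr0.
  have e1 : 1 <= (1 + e) ^+ n by rewrite exprn_ege1 // lerDl ltW.
  rewrite -natr1 exprS 2!mulrDl !mul1r; apply: lerD => //.
  by rewrite (ler_peMr (ltW e0)).
apply: (@le_trans _ _ ((1 + e) ^+ n / e * (a n * x ^+ n))).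
  by rewrite ler_wpM2r // mulr_ge0 // exprn_ge0.
have -> : (1 + e) ^+ n / e * (a n * x ^+ n) = a n * y ^+ n / e * r ^+ n.
  have -> : a n * y ^+ n / e * r ^+ n = a n / e * (y * r) ^+ n.
    by rewrite exprMn; ring.
  by rewrite yr exprMn; ring.
rewrite ler_wpM2r ?exprn_ge0 //.
by rewrite ler_wpM2r // invr_ge0 ltW.
Qed.

Lemma normc_horner_le (q : {poly R[i]}) t : 0 <= t <= 1 ->
  normc q.[t%:C] <= \sum_(i < size q) normc q`_i.
Proof.
move=> /andP[t0 t1]; rewrite horner_coef; apply: le_trans (normc_sum _ _ _) _.
apply: ler_sum => i _; rewrite Normc.normcM normcX normc_real ger0_norm //.
by rewrite ler_piMr ?normc_ge0 // exprn_ile1.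
Qed.

Definition trunc a (N n : nat) := if (n < N)%N then a n else 0.

(** Truncated generating function on the ray through [z]: evaluating it at [t] in
    [[0, 1]] is evaluating the truncated series at [t * z]. *)
Definition gfpoly a z (N : nat) : {poly R[i]} := \poly_(n < N) ((a n)%:C * z ^+ n).

Lemma coef_gfpoly a z N n : (gfpoly a z N)`_n = (trunc a N n)%:C * z ^+ n.
Proof. by rewrite coef_poly /trunc; case: ifP; rewrite ?mul0r. Qed.

Lemma coef_deriv_gfpoly a z N n :
  ((gfpoly a z N)^`())`_n = (fderiv (trunc a N) n)%:C * z ^+ n.+1.
Proof.
rewrite coef_deriv coef_gfpoly /fderiv rmorphM /= (rmorph_nat (real_complex R)).
by rewrite -mulrA mulr_natl.
Qed.

Lemma horner_gfpoly1 a z N :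
  (gfpoly a z N).[1] = series (fun n => (a n)%:C * z ^+ n) N.
Proof.
rewrite horner_poly /series /= big_mkord; apply: eq_bigr => i _.
by rewrite expr1n mulr1.
Qed.

Lemma horner_gfpoly0 a z N : (gfpoly a z N.+1).[0] = (a 0%N)%:C.
Proof. by rewrite horner_coef0 coef_gfpoly /trunc /= expr0 mulr1. Qed.

Lemma conv_gfpoly a h z n (p q : {poly R[i]}) (i j : nat) :
  (forall k, p`_k = (a k)%:C * z ^+ (k + i)) ->
  (forall k, q`_k = (h k)%:C * z ^+ (k + j)) ->
  (p * q)`_n = (conv a h n)%:C * z ^+ (n + (i + j)).
Proof.
move=> hp hq; rewrite coefM rmorph_sum mulr_suml; apply: eq_bigr => k _.
have -> : (n + (i + j) = (k + i) + (n - k + j))%N by have := ltn_ord k; lia.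
by rewrite hp hq [z ^+ (k + i + _)]exprD rmorphM /=; ring.
Qed.

Lemma normc_horner_gfpoly h z N t : (forall n, 0 <= h n) -> h 0%N = 0 ->
  (forall n, \sum_(k < n) h k <= 1) -> normc z <= 1 -> 0 <= t <= 1 ->
  normc (gfpoly h z N).[t%:C] <= normc z.
Proof.
move=> h0 h00 h1 z1 t01; have z0 := normc_ge0 z.
apply: le_trans (normc_horner_le _ t01) _.
apply: (@le_trans _ _ (\sum_(i < size (gfpoly h z N)) normc z * h i)); last first.
  by rewrite -mulr_sumr ler_piMr.
apply: ler_sum => -[[|i] iN] _ /=; rewrite coef_gfpoly Normc.normcM normcX normc_real.
  by rewrite /trunc h00 if_same normr0 mul0r mulr0.
rewrite mulrC; apply: ler_pM; rewrite ?exprn_ge0 //.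
  by rewrite exprS ler_piMr // exprn_ile1.
by rewrite /trunc; case: ifP => _; rewrite ?normr0 // ger0_norm.
Qed.

(** Coefficients of the error made in [(1 - h) * a' = beta * h' * a] by truncating both
    series at order [N]. *)
Definition defect beta h a N n := fderiv (trunc a N) n
  - conv (trunc h N) (fderiv (trunc a N)) n
  - beta * conv (fderiv (trunc h N)) (trunc a N) n.

Lemma defect_low beta h a N n : h 0%N = 0 -> neg_power beta h a ->
  (n.+1 < N)%N -> defect beta h a N n = 0.
Proof.
move=> h00 ha nN.
have low c k : (k <= n.+1)%N -> trunc c N k = c k.
  by move=> kn; rewrite /trunc (leq_ltn_trans kn nN).
have flow c k : (k <= n)%N -> fderiv (trunc c N) k = fderiv c k.
  by move=> kn; rewrite /fderiv low.
rewrite /defect flow // (neg_power_conv h00 ha).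
rewrite (@eq_conv _ (trunc h N) h _ (fderiv a)) => [|k kn|k kn]; last first.
- by rewrite flow.
- by rewrite low // leqW.
rewrite (@eq_conv _ (fderiv (trunc h N)) (fderiv h) _ a) => [|k kn|k kn]; last first.
- by rewrite low // leqW.
- by rewrite flow.
by ring.
Qed.

(** All the products involved are sums of nonnegative terms, so truncation only
    decreases them, and for the full series they add up to [fderiv a n]. *)
Lemma defect_high beta h a N n : 0 <= beta -> (forall n, 0 <= h n) ->
  h 0%N = 0 -> neg_power beta h a -> (N <= n.+1)%N ->
  `|defect beta h a N n| <= fderiv a n.
Proof.
move=> b0 h0 h00 ha Nn; have a0 := neg_power_ge0 b0 h0 ha.
have tr c : (forall k, 0 <= c k) -> forall k, 0 <= trunc c N k <= c k.
  by move=> c0 k; rewrite /trunc; case: ifP; rewrite ?lexx ?c0.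
have ftr c : (forall k, 0 <= c k) ->
    forall k, 0 <= fderiv (trunc c N) k <= fderiv c k.
  by move=> /tr c0 k; case/andP: (c0 k.+1) => *; rewrite mulr_ge0 //= ler_wpM2l.
have convle (b c b' c' : nat -> R) : (forall k, 0 <= b k <= b' k) ->
    (forall k, 0 <= c k <= c' k) -> 0 <= conv b c n <= conv b' c' n.
  move=> bb cc; rewrite sumr_ge0 /=; last first.
    by move=> k _; rewrite mulr_ge0 //; [case/andP: (bb k)|case/andP: (cc (n - k)%N)].
  apply: ler_sum => k _; case/andP: (bb k) => *; case/andP: (cc (n - k)%N) => *.
  exact: ler_pM.
have /andP[c1 c2] := convle _ _ _ _ (tr _ h0) (ftr _ a0).
have /andP[c3 c4] := convle _ _ _ _ (ftr _ h0) (tr _ a0).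
rewrite /defect {1}/fderiv {1}/trunc ltnNge Nn mulr0 sub0r -opprD normrN.
rewrite ger0_norm ?addr_ge0 ?mulr_ge0 // (neg_power_conv h00 ha).
by apply: lerD => //; rewrite ler_wpM2l.
Qed.

Lemma coef_defect beta h a z N n :
  ((1 - gfpoly h z N) * (gfpoly a z N)^`()
   - beta%:C *: ((gfpoly h z N)^`() * gfpoly a z N))`_n =
  (defect beta h a N n)%:C * z ^+ n.+1.
Proof.
rewrite mulrBl mul1r !coefB coefZ coef_deriv_gfpoly.
have e0 c k : (gfpoly c z N)`_k = (trunc c N k)%:C * z ^+ (k + 0).
  by rewrite addn0 coef_gfpoly.
have e1 c k : ((gfpoly c z N)^`())`_k = (fderiv (trunc c N) k)%:C * z ^+ (k + 1).
  by rewrite addn1 coef_deriv_gfpoly.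
rewrite (conv_gfpoly n (e0 h) (e1 a)) (conv_gfpoly n (e1 h) (e0 a)).
by rewrite !(addn0, add0n) addn1 /defect !rmorphB /= rmorphM /=; ring.
Qed.

(** Below order [N] the error vanishes; above, it is at most the corresponding term
    of [sum_n n * a n * |z| ^ n].  Hence it is bounded by a tail of this series. *)
Lemma normc_defect_le beta h a z N t : 0 <= beta -> (forall n, 0 <= h n) ->
  h 0%N = 0 -> neg_power beta h a -> 0 <= t <= 1 ->
  cvgn (series (fun n => n%:R * (a n * normc z ^+ n))) ->
  normc ((1 - gfpoly h z N) * (gfpoly a z N)^`()
   - beta%:C *: ((gfpoly h z N)^`() * gfpoly a z N)).[t%:C] <=
  limn (series (fun n => n%:R * (a n * normc z ^+ n)))
  - series (fun n => n%:R * (a n * normc z ^+ n)) N.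
Proof.
move=> b0 h0 h00 ha t01; set tl := fun n : nat => _ => tlcv.
have a_ge0 := neg_power_ge0 b0 h0 ha.
have tl0 n : 0 <= tl n by rewrite !mulr_ge0 ?exprn_ge0 ?normc_ge0.
apply: le_trans (normc_horner_le _ t01) _; set s := size _.
have le_tl n : normc ((defect beta h a N n)%:C * z ^+ n.+1) <=
    if (n.+1 < N)%N then 0 else tl n.+1.
  rewrite Normc.normcM normcX normc_real; case: ltnP => nN.
    by rewrite defect_low // normr0 mul0r.
  rewrite /tl mulrA ler_wpM2r ?exprn_ge0 ?normc_ge0 //.
  exact: defect_high.
rewrite lerBrDl.
apply: (@le_trans _ _ (\sum_(i < s.+1 + N) tl i)); last first.
  rewrite -(big_mkord xpredT); apply: nondecreasing_cvgn_le => //.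
  by apply: nondecreasing_series => k _ _.
rewrite [leRHS](bigID (fun i : 'I_(s.+1 + N) => (i < N)%N)) /=.
apply: lerD.
  by rewrite /series /= big_mkord (big_ord_widen _ tl (leq_addl s.+1 N)).
rewrite [leRHS]big_mkcond big_split_ord big_ord_recl /= -[leLHS]addr0.
apply: lerD; last by rewrite sumr_ge0 // => i _; case: ifP.
rewrite -[leLHS]add0r; apply: lerD; first by case: ifP.
by apply: ler_sum => i _; rewrite coef_defect /bump add1n; have := le_tl i; case: ifP.
Qed.

Lemma normc_gf_le h z w : (forall n, 0 <= h n) -> h 0%N = 0 ->
  (forall n, \sum_(k < n) h k <= 1) -> normc z <= 1 ->
  series (fun n => (h n)%:C * z ^+ n : R[i]) @ \oo --> (w : R[i]^o) ->
  normc w <= normc z.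
Proof.
move=> h0 h00 h1 z1 /cvg_normcP hw; rewrite -subr_le0.
apply: (ler_cvg_to (cvg_cst _) hw); apply: nearW => N.
rewrite lerBlDr; apply: (@le_trans _ _
  (normc (w - (gfpoly h z N).[1]) + normc (gfpoly h z N).[1])).
  by apply: le_trans (le_normcD _ _); rewrite subrK.
rewrite horner_gfpoly1 lerD2l -horner_gfpoly1.
by apply: (@normc_horner_gfpoly h z N 1) => //; rewrite ler01 lexx.
Qed.

(** The product [A_N(t z) * (1 - H_N(t z)) ^ beta] of truncated series equals 1 at
    [t = 0], and its derivative in [t] is the truncation error times a bounded factor.
    Hence it tends to 1 at [t = 1], and so does [A_N(z) * (1 - H(z)) ^ beta]. *)
Theorem neg_power_cpow (beta : R) h a z w : 0 <= beta ->
  (forall n, 0 <= h n) -> h 0%N = 0 -> (forall n, \sum_(k < n) h k <= 1) ->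
  neg_power beta h a -> normc z < 1 ->
  series (fun n => (h n)%:C * z ^+ n : R[i]) @ \oo --> (w : R[i]^o) ->
  series (fun n => (a n)%:C * z ^+ n : R[i]) @ \oo --> (cpow (1 - w) (- beta) : R[i]^o).
Proof.
move=> b0 h0 h00 h1 ha z1 hw.
have a_ge0 := neg_power_ge0 b0 h0 ha.
have z0 := normc_ge0 z.
pose tl n := n%:R * (a n * normc z ^+ n).
have tlcv : cvgn (series tl).
  apply: cvg_series_deriv => //; last by rewrite z0.
  by move=> r r01; exact: (neg_power_bounded b0 h0 h1 ha r01).
pose tau N := limn (series tl) - series tl N.
have tau0 : tau N @[N --> \oo] --> 0.
  by rewrite -(subrr (limn (series tl))); apply: cvgB tlcv; exact: cvg_cst.
pose H N := gfpoly h z N.+1; pose A N := gfpoly a z N.+1.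
pose W N t := 1 - (H N).[t%:C].
pose c N t := cpow (W N t) beta.
pose g N t := (A N).[t%:C] * c N t.
pose D N := (1 - H N) * (A N)^`() - beta%:C *: ((H N)^`() * A N).
have Hle N t : 0 <= t <= 1 -> normc (H N).[t%:C] <= normc z.
  by move=> t01; apply: normc_horner_gfpoly => //; exact: ltW.
have W0 N t : 0 <= t <= 1 -> 1 - normc z <= Re (W N t).
  move=> t01; rewrite /W ReD ReN /= lerD2l lerN2.
  exact: le_trans (ler_norm _) (le_trans (Re_le_normc _) (Hle N t t01)).
have W_gt0 N t : 0 <= t <= 1 -> 0 < Re (W N t).
  by move=> /(W0 N); apply: lt_le_trans; rewrite subr_gt0.
have W_neq0 N t : 0 <= t <= 1 -> W N t != 0.
  move=> t01; apply: contraTneq (W_gt0 N t t01) => ->.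
  by rewrite ltxx.
have gd N t : 0 <= t <= 1 -> is_cderive t (g N) (c N t / W N t * (D N).[t%:C]).
  move=> t01.
  have wd : is_cderive t (W N) (0 - (H N)^`().[t%:C]).
    by apply: is_cderiveB; [exact: is_cderive_cst|exact: is_cderive_poly].
  have ld := is_cderiveZ beta%:C (is_cderive_log (W_gt0 N t t01) wd).
  apply: is_cderive_eq (is_cderiveM (is_cderive_poly t (A N)) (is_cderive_exp ld)) _.
  have -> : (D N).[t%:C] = W N t * (A N)^`().[t%:C]
      - beta%:C * ((H N)^`().[t%:C] * (A N).[t%:C]).
    by rewrite /D hornerD hornerN hornerZ !hornerM hornerD hornerN -polyC1 hornerC.
  rewrite -[cexp (_ * _)]/(c N t).
  have := W_neq0 N t t01; move: (W N t) (c N t) (A N).[_] (A N)^`().[_] (H N)^`().[_].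
  by move=> w' c' x1 x2 x3 w0; field.
pose B := expR (beta * ln 2) / (1 - normc z).
have gb N t : 0 <= t <= 1 -> normc (c N t / W N t * (D N).[t%:C]) <= B * tau N.+1.
  move=> t01; have nW : 0 < normc (W N t).
    exact: lt_le_trans (W_gt0 N t t01) (le_trans (ler_norm _) (Re_le_normc _)).
  rewrite Normc.normcM [normc (c N t / _)]Normc.normcM Normc.normcV.
  apply: ler_pM; rewrite ?mulr_ge0 ?invr_ge0 ?normc_ge0 //.
    apply: ler_pM; rewrite ?invr_ge0 ?normc_ge0 //.
      rewrite normc_cpow ler_expR ler_wpM2l // ler_ln ?posrE //.
      apply: le_trans (le_normcD _ _) _; rewrite normcN Normc.normc1.
      have := Hle N t t01; move: (normc (H N).[_]) => y; lra.
    rewrite lef_pV2 ?posrE ?subr_gt0 //.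
    exact: le_trans (W0 N t t01) (le_trans (ler_norm _) (Re_le_normc _)).
  exact: normc_defect_le.
have g0 N : g N 0 = 1.
  rewrite /g /c /W (_ : (0 : R)%:C = 0) // !horner_gfpoly0 h00 /= subr0 cpow1.
  by rewrite mulr1; case: ha => ->.
have g1 N : g N 1 = series (fun n => (a n)%:C * z ^+ n) N.+1 *
    cpow (1 - series (fun n => (h n)%:C * z ^+ n) N.+1) beta.
  by rewrite /g /c /W (_ : (1 : R)%:C = 1) // !horner_gfpoly1.
have cg : g N 1 @[N --> \oo] --> (1 : R[i]^o).
  apply/cvg_normcP; apply: (@squeeze_cvgr _ _ _ _ (fun=> 0)
      (fun N => 2 * (B * tau N.+1))).
  - apply: nearW => N; rewrite normc_ge0 normcB -(g0 N).
    exact: cderive_bound (gd N) (gb N).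
  - exact: cvg_cst.
  - rewrite (_ : (0 : R) = 2 * (B * 0)); last by rewrite !mulr0.
    by apply: cvgMl_tmp; apply: cvgMl_tmp; rewrite (cvg_shiftS tau).
have cw : 1 - series (fun n => (h n)%:C * z ^+ n) N.+1 @[N --> \oo] --> (1 - w : R[i]^o).
  move/cvg_normcP : hw; rewrite -cvg_shiftS => hw; apply/cvg_normcP.
  apply: cvg_near_eq hw; apply: nearW => N.
  by rewrite normcB; congr normc; ring.
have w0 : 0 < Re (1 - w).
  rewrite ReD ReN subr_gt0; apply: le_lt_trans (le_trans (ler_norm _) (Re_le_normc w)) _.
  exact: le_lt_trans (normc_gf_le h0 h00 h1 (ltW z1) hw) z1.
have cA := @cvgM R[i] nat \oo _ _ _ _ _ cg (cvg_cpow (a := - beta) w0 cw).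
apply/cvg_normcP; rewrite -cvg_shiftS.
have /cvg_normcP : series (fun n => (a n)%:C * z ^+ n : R[i]) N.+1 @[N --> \oo]
    --> (cpow (1 - w) (- beta) : R[i]^o).
  rewrite (_ : (fun N => _) = fun N => g N 1 *
      cpow (1 - series (fun n => (h n)%:C * z ^+ n) N.+1) (- beta)).
    by rewrite mul1r in cA; exact: cA.
  by apply/funext => N; rewrite g1 -mulrA -cpowD subrr cpow0 mulr1.
by [].
Qed.
End NegPowerSeries.

(** * The complex exponential series *)

Section ComplexExponentialSeries.
Variable R : realType.
Implicit Types (z v : R[i]) (t : R).
Local Notation Re := (@complex.Re R).
Local Notation normc := (@Normc.normc R).

(** The derivative in [t] of the [N]-th partial sum at [t * v] times [cexp (- t * v)]
    only involves the last term of that sum: the others telescope. *)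
Lemma cvg_series_cexp v :
  series (fun k => (k`!%:R^-1 : R)%:C * v ^+ k : R[i]) @ \oo --> (cexp v : R[i]^o).
Proof.
pose a k : R := k`!%:R^-1.
have dE N : (gfpoly a v N.+1)^`() - v *: gfpoly a v N.+1 =
    - (((a N)%:C * v ^+ N.+1) *: 'X^N).
  apply/polyP => n; rewrite coefB coefN !coefZ coefXn coef_deriv_gfpoly coef_gfpoly.
  rewrite /fderiv /trunc !ltnS.
  have fa : n.+1%:R * a n.+1 = a n.
    by rewrite /a factS natrM invfM mulrA divff ?mul1r // pnatr_eq0.
  case: (ltngtP n N) => [nN|nN|->].
  - by rewrite fa mulr0 oppr0 exprS mulrCA subrr.
  - by rewrite mulr0 !mul0r mulr0 subr0 mulr0 oppr0.
  - by rewrite mulr0 mul0r sub0r mulr1 exprS mulrCA.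
pose c t := cexp (- v * t%:C).
pose g N t := (gfpoly a v N.+1).[t%:C] * c t.
pose dg N t := c t * (- ((a N)%:C * v ^+ N.+1 * t%:C ^+ N)).
have gd N t : is_cderive t (g N) (dg N t).
  have ed := is_cderive_exp (is_cderiveZ (- v) (is_cderive_real t)).
  apply: is_cderive_eq (is_cderiveM (is_cderive_poly t (gfpoly a v N.+1)) ed) _.
  rewrite -/(c t) mulr1 /dg.
  have := congr1 (fun q => q.[t%:C]) (dE N).
  rewrite !(hornerD, hornerN, hornerZ) hornerXn => <-; ring.
pose B := expR (normc v) * normc v.
have gb N t : 0 <= t <= 1 -> normc (dg N t) <= B * exp_coeff (normc v) N.
  move=> /andP[t0 t1]; rewrite /dg Normc.normcM normcN /B -[leRHS]mulrA.
  apply: ler_pM; rewrite ?normc_ge0 //.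
    rewrite normc_cexp ler_expR mulrC ReZ ReN mulrN -mulNr.
    apply: le_trans (ler_norm _) _; rewrite normrM normrN (ger0_norm t0).
    apply: le_trans (Re_le_normc v); rewrite ler_piMl //.
  rewrite !Normc.normcM !normcX !normc_real !ger0_norm // ?invr_ge0 //.
  rewrite exp_coeffE exprS.
  have : a N * (normc v * normc v ^+ N) * t ^+ N <= a N * (normc v * normc v ^+ N).
    by rewrite ler_piMr ?exprn_ile1 // !mulr_ge0 ?exprn_ge0 ?normc_ge0 ?invr_ge0.
  by move/le_trans; apply; rewrite mulrCA.
have g0 N : g N 0 = 1.
  rewrite /g /c (_ : (0 : R)%:C = 0) // horner_gfpoly0 mulr0 cexp0 mulr1.
  by rewrite /a fact0 invr1.
have g1 N : g N 1 = series (fun k => (a k)%:C * v ^+ k) N.+1 * cexp (- v).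
  by rewrite /g /c (_ : (1 : R)%:C = 1) // horner_gfpoly1 mulr1.
have cg : g N 1 @[N --> \oo] --> (1 : R[i]^o).
  apply/cvg_normcP; apply: (@squeeze_cvgr _ _ _ _ (fun=> 0)
      (fun N => 2 * (B * exp_coeff (normc v) N))).
  - apply: nearW => N; rewrite normc_ge0 normcB -(g0 N).
    by apply: (cderive_bound (fun t _ => gd N t)) => t t01; exact: gb.
  - exact: cvg_cst.
  - rewrite (_ : (0 : R) = 2 * (B * 0)); last by rewrite !mulr0.
    by apply: cvgMl_tmp; apply: cvgMl_tmp; exact: cvg_exp_coeff.
apply/cvg_normcP; rewrite -cvg_shiftS.
have cA := @cvgM R[i] nat \oo _ _ _ _ _ cg (cvg_cst (cexp v : R[i]^o)).
have /cvg_normcP : series (fun k => (a k)%:C * v ^+ k : R[i]) N.+1 @[N --> \oo]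
    --> (cexp v : R[i]^o).
  rewrite (_ : (fun N => _) = fun N => g N 1 * cexp v).
    by rewrite mul1r in cA; exact: cA.
  by apply/funext => N; rewrite g1 -mulrA -cexpD addNr cexp0 mulr1.
by [].
Qed.

End ComplexExponentialSeries.

(** * The Gamma function *)

Section Gamma.
Variable R : realType.
Implicit Types (b c x : R) (n k : nat).
Local Notation mu := (@lebesgue_measure R).

(** The integrand of [Gamma(b) / c ^ b].  The rate [c] is kept as a parameter because
    rates below 1 serve as dominating functions. *)
Definition gamma_kernel c b x : R := x `^ (b - 1) * expR (- (c * x)).

Lemma gamma_kernel_ge0 c b x : 0 <= gamma_kernel c b x.
Proof. by rewrite mulr_ge0 ?powR_ge0 ?expR_ge0. Qed.

Lemma powR_le_expR b c : 0 <= b -> 0 < c ->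
  exists K, forall x, 0 < x -> x `^ b <= K * expR (c * x).
Proof.
rewrite le_eqVlt => /predU1P[<- c0|b0 c0].
  exists 1 => x x0; rewrite powRr0 mul1r -expR0 ler_expR.
  by rewrite mulr_ge0 // ltW.
exists ((b / c) `^ b) => x x0.
have cb : 0 < c / b by rewrite divr_gt0.
have bc : 0 < b / c by rewrite divr_gt0.
have e : x <= b / c * expR (c * x / b).
  have := expR_ge1Dx (c * x / b).
  rewrite -ler_pdivrMl // invf_div => h; apply: le_trans h.
  by rewrite mulrAC ler_wpDl.
apply: (@le_trans _ _ ((b / c * expR (c * x / b)) `^ b)).
  by apply: ge0_ler_powR; rewrite ?nnegrE // ltW // mulr_gt0 ?expR_gt0.
rewrite powRM ?expR_ge0 ?(ltW bc) // -expRM divfK //.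
by rewrite gt_eqF.
Qed.

Lemma is_derive_gamma c b x : 0 < x ->
  is_derive x 1 (fun y => y `^ b * expR (- (c * y)))
    (b * gamma_kernel c b x - c * gamma_kernel c (b + 1) x).
Proof.
move=> x0; have pd := is_derive1_powR b x0.
have ed : is_derive x 1 (fun y => expR (- (c * y))) (- c * expR (- (c * x))).
  have ld : is_derive x 1 (fun y => - (c * y)) (- c).
    rewrite (_ : (fun y => _) = (- c) *: id); last first.
      by apply/funext => y; rewrite -[RHS]/(- c * y) mulNr.
    apply: is_derive_eq (is_deriveZ (- c) (is_derive_id x 1)) _.
    by rewrite /GRing.scale /= mulr1.
  by apply: is_derive_eq; rewrite /GRing.scale /= mulrC.
apply: is_derive_eq (is_deriveM pd ed) _.
by rewrite /gamma_kernel addrK /GRing.scale /=; ring.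
Qed.

Lemma continuous_gamma_kernel c b x : 0 < x -> {for x, continuous (gamma_kernel c b)}.
Proof.
move=> x0; apply: differentiable_continuous; apply/derivable1_diffP.
by case: (is_derive_gamma c (b - 1) x0).
Qed.

Definition seg n : set R := `[n.+1%:R^-1, n.+1%:R].

Lemma seg_gt0 n x : x \in `[n.+1%:R^-1, n.+1%:R] -> 0 < x.
Proof. by rewrite in_itv /= => /andP[h _]; apply: lt_le_trans h; rewrite invr_gt0. Qed.

Lemma nondecreasing_seg : nondecreasing_seq seg.
Proof.
move=> n k nk; apply/subsetPset => x; rewrite /seg /= !in_itv /= => /andP[h1 h2].
apply/andP; split; [apply: le_trans h1|apply: le_trans h2 _].
  by rewrite lef_pV2 ?posrE // ler_nat.
by rewrite ler_nat.
Qed.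

Lemma bigcup_seg : \bigcup_n seg n = `]0, +oo[%classic.
Proof.
apply/seteqP; split => x.
  by move=> [n _ /= /seg_gt0 x0]; rewrite in_itv /= x0.
rewrite /= in_itv /= andbT => x0.
pose N := (Num.truncn x + Num.truncn x^-1)%N.
exists N => //; rewrite /seg /= in_itv /=.
have h (y : R) : 0 < y -> y <= (Num.truncn y).+1%:R.
  by move=> y0; apply/ltW/truncnS_gt.
apply/andP; split.
  rewrite -[leRHS]invrK lef_pV2 ?posrE ?invr_gt0 //.
  by apply: le_trans (h _ _) _; rewrite ?invr_gt0 // ler_nat /N ltnS leq_addl.
by apply: le_trans (h _ x0) _; rewrite ler_nat /N ltnS leq_addr.
Qed.

Lemma within_continuous_gamma c b n :
  {within seg n, continuous (gamma_kernel c b)}.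
Proof.
apply: continuous_in_subspaceT => x /[!inE] /seg_gt0.
exact: continuous_gamma_kernel.
Qed.

Lemma measurable_gamma c b : measurable_fun (`]0%R, +oo[%classic : set R) (gamma_kernel c b).
Proof.
apply: open_continuous_measurable_fun; first exact: interval_open.
by move=> x /[!inE] /=; rewrite in_itv /= andbT; exact: continuous_gamma_kernel.
Qed.

Lemma integrable_gamma_seg c b n :
  mu.-integrable (seg n) (EFin \o gamma_kernel c b).
Proof.
by apply: continuous_compact_integrable;
  [exact: segment_compact|exact: within_continuous_gamma].
Qed.

Lemma integrable_scale (D : set R) (k : R) (f : R -> R) : measurable D ->
  mu.-integrable D (EFin \o f) -> mu.-integrable D (EFin \o (fun x => k * f x)).
Proof.
move=> mD fi; apply: (@eq_integrable _ _ _ mu D mD (fun x => k%:E * (f x)%:E)%E).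
  by move=> x _; rewrite /= EFinM.
exact: (@integrableZl _ _ _ mu D mD k (EFin \o f) fi).
Qed.

(** Integration by parts, on compact intervals because the kernel is unbounded near
    0 when [b < 1]. *)
Lemma integral_gamma_seg c b n :
  b * (\int[mu]_(x in seg n) gamma_kernel c b x) -
  c * (\int[mu]_(x in seg n) gamma_kernel c (b + 1) x) =
  n.+1%:R `^ b * expR (- (c * n.+1%:R)) -
  n.+1%:R^-1 `^ b * expR (- (c * n.+1%:R^-1)).
Proof.
have i1 := integrable_gamma_seg c b n; have i2 := integrable_gamma_seg c (b + 1) n.
have mS : measurable (seg n) by exact: measurable_itv.
have [->|n0] := eqVneq n 0%N.
  rewrite /seg invr1 set_itv1 !Rintegral_set1 !mulr0 !subrr //.
rewrite -!RintegralZl // -RintegralB //; last 2 first.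
- exact: integrable_scale.
- exact: integrable_scale.
rewrite /Rintegral (@continuous_FTC2 _ _ (fun y => y `^ b * expR (- (c * y)))) //.
- rewrite (lt_trans (y := 1)) ?invf_lt1 ?ltr1n ?ltr0n //; lia.
- apply: continuous_in_subspaceT => x /[!inE] /seg_gt0 x0.
  by apply: cvgB; apply: cvgMl_tmp; exact: continuous_gamma_kernel.
- have cF x : 0 < x -> {for x, continuous (fun y => y `^ b * expR (- (c * y)))}.
    move=> x0; apply: differentiable_continuous; apply/derivable1_diffP.
    by case: (is_derive_gamma c b x0).
  split.
  + by move=> x /subset_itv_oo_cc /seg_gt0 x0; case: (is_derive_gamma c b x0).
  + by apply: cvg_at_right_filter; apply: cF; rewrite invr_gt0.
  + by apply: cvg_at_left_filter; apply: cF.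
- move=> x /subset_itv_oo_cc /seg_gt0 x0.
  by rewrite derive1E; case: (is_derive_gamma c b x0).
Qed.

Definition gamma_integral c b := (\int[mu]_(x in `]0%R, +oo[) (gamma_kernel c b x)%:E)%E.

Lemma gamma_integral_ge0 c b : (0 <= gamma_integral c b)%E.
Proof. by apply: integral_ge0 => x _; rewrite lee_fin gamma_kernel_ge0. Qed.

Lemma cvg_gamma_seg c b : (\int[mu]_(x in seg n) (gamma_kernel c b x)%:E)%E
  @[n --> \oo] --> gamma_integral c b.
Proof.
rewrite /gamma_integral -bigcup_seg.
apply: ge0_nondecreasing_set_cvg_integral.
- exact: nondecreasing_seg.
- by move=> n; exact: measurable_itv.
- by move=> n; case/integrableP: (integrable_gamma_seg c b n).
- by move=> n x _; rewrite lee_fin gamma_kernel_ge0.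
Qed.

Lemma cvg_gamma_boundary c b : 0 < c -> 0 < b ->
  n.+1%:R `^ b * expR (- (c * n.+1%:R)) -
  n.+1%:R^-1 `^ b * expR (- (c * n.+1%:R^-1)) @[n --> \oo] --> (0 : R).
Proof.
move=> c0 b0; rewrite -[X in _ --> X]subr0; apply: cvgB.
  have c20 : 0 < c / 2 by rewrite divr_gt0.
  have [K hK] := powR_le_expR (ltW b0) c20.
  apply: (@squeeze_cvgr _ _ _ _ (fun=> 0)
      (fun n => K * expR (- ((c / 2) * n.+1%:R)))).
  - apply: nearW => n; rewrite mulr_ge0 ?powR_ge0 ?expR_ge0 //=.
    apply: (@le_trans _ _ (K * expR (c / 2 * n.+1%:R) * expR (- (c * n.+1%:R)))).
      by rewrite ler_wpM2r ?expR_ge0 // hK.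
    rewrite -mulrA -expRD (_ : _ + _ = - (c / 2 * n.+1%:R)) //.
    by rewrite {2}[c]splitr; ring.
  - exact: cvg_cst.
  - rewrite -[X in _ --> X](mulr0 K); apply: cvgMl_tmp.
    have cy : c / 2 * n.+1%:R @[n --> \oo] --> +oo.
      apply/cvgryPge => A; near=> n; rewrite mulrC -ler_pdivrMr //.
      apply: (@le_trans _ _ n%:R); last by rewrite ler_nat.
      by near: n; exact: nbhs_infty_ger.
    exact: (cvg_comp _ _ cy (@cvgr_expR R)).
apply: (@squeeze_cvgr _ _ _ _ (fun=> 0) (fun n => n.+1%:R^-1 `^ b)).
- apply: nearW => n; rewrite mulr_ge0 ?powR_ge0 ?expR_ge0 //=.
  rewrite ler_piMr ?powR_ge0 // -expR0 ler_expR oppr_le0 mulr_ge0 //.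
  exact: ltW.
- exact: cvg_cst.
- have /cvg_at_rightP := powR_cvg0 b0; apply; split; last exact: cvg_harmonic.
  by move=> n; rewrite invr_gt0.
Unshelve. all: by end_near. Qed.

(** Finiteness is propagated downwards in [b]: near 0 the kernel with exponent
    [b + 1] is better behaved. *)
Lemma gamma_integral_step c b : 0 < c -> 0 < b ->
  (gamma_integral c (b + 1) < +oo)%E ->
  gamma_integral c b = (c / b * fine (gamma_integral c (b + 1)))%:E.
Proof.
move=> c0 b0 fin.
have fin' : gamma_integral c (b + 1) \is a fin_num.
  by rewrite ge0_fin_numE ?gamma_integral_ge0.
have JE d : (fun n => \int[mu]_(x in seg n) (gamma_kernel c d x)%:E)%E =
    EFin \o (fun n => \int[mu]_(x in seg n) gamma_kernel c d x).
  apply/funext => n; apply/esym/fineK.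
  by apply: integrable_fin_num; [exact: measurable_itv|exact: integrable_gamma_seg].
have c1 : \int[mu]_(x in seg n) gamma_kernel c (b + 1) x @[n --> \oo] -->
    fine (gamma_integral c (b + 1)).
  by have := @cvg_gamma_seg c (b + 1); rewrite -{1}(fineK fin') => /fine_cvg.
have c2 : \int[mu]_(x in seg n) gamma_kernel c b x @[n --> \oo] -->
    c / b * fine (gamma_integral c (b + 1)).
  rewrite (_ : (fun n => _) = fun n =>
      c / b * (\int[mu]_(x in seg n) gamma_kernel c (b + 1) x) +
      b^-1 * (n.+1%:R `^ b * expR (- (c * n.+1%:R)) -
      n.+1%:R^-1 `^ b * expR (- (c * n.+1%:R^-1)))).
    rewrite -[X in _ --> X]addr0 -[X in _ --> _ + X](mulr0 b^-1).
    apply: cvgD; apply: cvgMl_tmp => //; exact: cvg_gamma_boundary.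
  apply/funext => n; rewrite -integral_gamma_seg; field.
  exact: lt0r_neq0.
have c3 := @cvg_gamma_seg c b.
have c4 : (EFin \o (fun n => \int[mu]_(x in seg n) gamma_kernel c b x)) @ \oo -->
    (c / b * fine (gamma_integral c (b + 1)))%:E.
  by apply: cvg_EFin => //; exact: nearW.
by rewrite -JE in c4; exact: (cvg_unique _ c3 c4).
Qed.

Lemma gamma_integral_lty c b : 0 < c -> 0 < b -> (gamma_integral c b < +oo)%E.
Proof.
move=> c0.
have base d : 1 <= d -> (gamma_integral c d < +oo)%E.
  move=> d1; have c20 : 0 < c / 2 by rewrite divr_gt0.
  have [|K hK] := @powR_le_expR (d - 1) _ _ c20; first by rewrite subr_ge0.
  have K0 : 0 <= K.
    have := hK 1 ltr01; rewrite powR1 => /(le_trans ler01).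
    by rewrite pmulr_lge0 // expR_gt0.
  pose M := K / (c / 2).
  have M0 : 0 <= M by rewrite divr_ge0 // ltW.
  have mp : measurable_fun [set: R] (EFin \o exponential_pdf (c / 2)).
    by apply/measurable_EFinP; exact: measurable_exponential_pdf.
  apply: (@le_lt_trans _ _ (\int[mu]_(x in `]0%R, +oo[)
      (M%:E * (exponential_pdf (c / 2) x)%:E))%E).
    apply: ge0_le_integral => //.
    - by move=> x _; rewrite lee_fin gamma_kernel_ge0.
    - by apply/measurable_EFinP; exact: measurable_gamma.
    - by apply: measurable_funTS; apply: measurable_funeM.
    - move=> x /=; rewrite in_itv /= andbT => x0.
      rewrite -EFinM lee_fin exponential_pdfE ?(ltW x0) // /M mulrA divfK ?gt_eqF //.
      apply: (@le_trans _ _ (K * expR (c / 2 * x) * expR (- (c * x)))).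
        by rewrite ler_wpM2r ?expR_ge0 // hK.
      rewrite -mulrA -expRD (_ : _ + _ = - (c / 2) * x) //.
      by rewrite {2}[c]splitr; ring.
  apply: (@le_lt_trans _ _ (\int[mu]_x (M%:E * (exponential_pdf (c / 2) x)%:E))%E).
    apply: ge0_subset_integral => //; first by apply: measurable_funeM.
    by move=> x _; rewrite mule_ge0 // lee_fin exponential_pdf_ge0 // ltW.
  rewrite ge0_integralZl //; last by move=> x _; rewrite lee_fin exponential_pdf_ge0 // ltW.
  by rewrite integral_exponential_pdf // mule1 ltry.
have step k d : 0 < d -> 1 <= d + k%:R -> (gamma_integral c d < +oo)%E.
  elim: k d => [|k IH] d d0; first by rewrite addr0; exact: base.
  rewrite -natr1 [k%:R + 1]addrC addrA => dk.
  rewrite gamma_integral_step ?ltry //; apply: IH dk; exact: addr_gt0.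
by move=> b0; apply: (step 1%N) => //; rewrite lerDr ltW.
Qed.

Definition Gamma b := fine (gamma_integral 1 b).

Lemma GammaE b : 0 < b -> gamma_integral 1 b = (Gamma b)%:E.
Proof.
by move=> b0; rewrite /Gamma fineK // ge0_fin_numE ?gamma_integral_ge0 //
  gamma_integral_lty.
Qed.

Lemma GammaS b : 0 < b -> Gamma (b + 1) = b * Gamma b.
Proof.
move=> b0; rewrite {2}/Gamma gamma_integral_step //.
  by rewrite /= mulrA mulrCA mulfV ?mul1r // gt_eqF.
by apply: gamma_integral_lty; rewrite // addr_gt0.
Qed.

Lemma Gamma_gt0 b : 0 < b -> 0 < Gamma b.
Proof.
move=> b0; rewrite -lte_fin -GammaE //.
pose m := expR (- (`|b - 1| * ln 2)) * expR (- 2).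
apply: (@lt_le_trans _ _ (\int[mu]_(x in `[1%R, 2%R]) m%:E)%E).
  rewrite integral_cst //= lebesgue_measure_itv /= lte_fin ltr1n /=.
  by rewrite mule_gt0 ?lte_fin ?mulr_gt0 ?expR_gt0.
apply: (@le_trans _ _ (\int[mu]_(x in `[1%R, 2%R]) (gamma_kernel 1 b x)%:E)%E).
  apply: ge0_le_integral => //.
  - by move=> x _; rewrite lee_fin ltW // mulr_gt0 ?expR_gt0.
  - apply/measurable_EFinP; apply: measurable_funS (measurable_gamma 1 b) => //.
    by move=> x /=; rewrite !in_itv /= andbT => /andP[x1 _]; exact: lt_le_trans x1.
  - move=> x /=; rewrite in_itv /= => /andP[x1 x2]; rewrite lee_fin.
    have x0 : 0 < x := lt_le_trans ltr01 x1.
    rewrite /gamma_kernel /powR gt_eqF //; apply: ler_pM; rewrite ?expR_ge0 //.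
      rewrite ler_expR lerNl -mulNr.
      apply: (@le_trans _ _ (`|b - 1| * ln x)).
        by rewrite ler_wpM2r ?ln_ge0 // -normrN ler_norm.
      by rewrite ler_wpM2l // ler_ln ?posrE.
    by rewrite mul1r ler_expR lerN2.
apply: ge0_subset_integral => //.
- by apply/measurable_EFinP; exact: measurable_gamma.
- by move=> x _; rewrite lee_fin gamma_kernel_ge0.
- by move=> x /=; rewrite !in_itv /= andbT => /andP[x1 _]; exact: lt_le_trans x1.
Qed.

End Gamma.

(** * The complex Gamma integral *)

Section GammaIntegral.
Variable R : realType.
Implicit Types (u z : R[i]) (x : R).
Local Notation mu := (@lebesgue_measure R).
Local Notation normc := (@Normc.normc R).
Local Notation Re := (@complex.Re R).
Local Notation Im := (@complex.Im R).

(** The functional equation of Gamma is the recursion of the binomial series of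
    [(1 - z) ^ (- beta)]. *)
Lemma neg_power_binomial (beta : R) : 0 < beta ->
  neg_power beta (fun k => (k == 1)%:R)
    (fun k => Gamma (beta + k%:R) / (k`!%:R * Gamma beta)).
Proof.
move=> b0; have G0 := lt0r_neq0 (Gamma_gt0 b0).
split=> [|n]; first by rewrite addr0 fact0 mul1r divff.
rewrite big_ord_recr /= big1 => [|i _]; last first.
  by rewrite gtn_eqF ?mulr0 ?mul0r //; have := ltn_ord i; lia.
rewrite subSnn eqxx !mulr1 add0r -natr1 addrA GammaS; last by rewrite ltr_wpDr.
rewrite factS natrM -natr1.
have f0 : n`!%:R != 0 :> R by rewrite pnatr_eq0 -lt0n fact_gt0.
have n0 : n%:R + 1 != 0 :> R by rewrite natr1 pnatr_eq0.
by field; rewrite G0 f0 n0.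
Qed.

Lemma cvg_binomial_series (beta : R) u : 0 < beta -> normc u < 1 ->
  series (fun k => (Gamma (beta + k%:R) / (k`!%:R * Gamma beta))%:C * u ^+ k : R[i])
    @ \oo --> (cpow (1 - u) (- beta) : R[i]^o).
Proof.
move=> b0 u1.
apply: (neg_power_cpow (ltW b0) _ _ _ (neg_power_binomial b0) u1) => //.
- move=> n; rewrite (_ : \sum_(k < n) _ = \sum_(k < n | val k == 1%N) 1); last first.
    by rewrite [RHS]big_mkcond; apply: eq_bigr => k _; case: eqP.
  case: n => [|[|n]]; rewrite ?big_ord0 ?ler01 //.
    by rewrite big_mkcond big_ord_recl big_ord0 /= addr0.
  by rewrite (big_pred1 (Ordinal (isT : (1 < n.+2)%N))).
- apply/cvg_normcP; apply: cvg_near_cst; near=> n.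
  have n2 : (1 < n)%N by near: n; exact: nbhs_infty_gt.
  rewrite /series /= big_mkord (bigD1 (Ordinal n2)) //= mul1r expr1.
  rewrite big1 ?addr0 ?subrr ?Normc.normc0 // => i ni.
  by rewrite (_ : (nat_of_ord i == 1%N) = false) ?mul0r //; apply/negbTE.
Unshelve. all: by end_near. Qed.

Lemma series_exp_coeff_le x n : 0 <= x -> \sum_(k < n) exp_coeff x k <= expR x.
Proof.
move=> x0; apply: sum_le_cvg_series; last exact: is_cvg_series_exp_coeff.
by move=> k; exact: exp_coeff_ge0.
Qed.

(* [proj] is Re or Im: the two components of the integral are treated at once *)
Variable proj : R[i] -> R.
Hypothesis proj_sum : forall n (F : 'I_n -> R[i]),
  proj (\sum_(i < n) F i) = \sum_(i < n) proj (F i).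
Hypothesis projZ : forall x z, proj (x%:C * z) = x * proj z.
Hypothesis proj_le : forall z, `|proj z| <= normc z.
Hypothesis proj_cvg : forall (s : nat -> R[i]) (l : R[i]),
  s @ \oo --> (l : R[i]^o) -> proj (s n) @[n --> \oo] --> proj l.

(** The [k]-th term in the expansion of [cexp (u * x)] times the kernel, with [x ^ k]
    absorbed into the exponent of the latter. *)
Let term (beta : R) u k x := proj (u ^+ k) / k`!%:R * gamma_kernel 1 (beta + k%:R) x.

Lemma integral_gamma_terms (beta : R) u n : 0 < beta ->
  mu.-integrable `]0%R, +oo[ (EFin \o (fun x => \sum_(k < n) term beta u k x)) /\
  \int[mu]_(x in `]0%R, +oo[) (\sum_(k < n) term beta u k x) =
  \sum_(k < n) proj (u ^+ k) / k`!%:R * Gamma (beta + k%:R).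
Proof.
move=> b0; have mD : measurable (`]0%R, +oo[%classic : set R) by exact: measurable_itv.
have ik k : mu.-integrable `]0%R, +oo[ (EFin \o gamma_kernel 1 (beta + k%:R)).
  have bk : 0 < beta + k%:R by rewrite ltr_wpDr.
  apply/integrableP; split; first by apply/measurable_EFinP; exact: measurable_gamma.
  under eq_integral => x _ do rewrite /= ger0_norm ?gamma_kernel_ge0 //.
  exact: gamma_integral_lty.
have ik' k : mu.-integrable `]0%R, +oo[ (EFin \o term beta u k).
  exact: integrable_scale.
elim: n => [|n [IHi IHv]].
  rewrite (_ : (fun x => _) = fun=> 0); last by apply/funext => x; rewrite big_ord0.
  split; first exact: integrable0.
  by rewrite /Rintegral integral0 big_ord0.
rewrite (_ : (fun x => _) = fun x => \sum_(k < n) term beta u k x + term beta u n x);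
  last by apply/funext => x; rewrite big_ord_recr.
split.
  apply: (@eq_integrable _ _ _ mu _ mD (fun x => (EFin \o (fun x =>
    \sum_(k < n) term beta u k x)%R) x + (EFin \o term beta u n) x)%E).
    by move=> x _; rewrite /= EFinD.
  exact: integrableD.
rewrite RintegralD // IHv big_ord_recr; congr (_ + _).
by rewrite /term RintegralZl.
Qed.

Lemma gamma_termE (beta : R) u k x : 0 < x ->
  term beta u k x =
  proj ((k`!%:R^-1)%:C * (u * x%:C) ^+ k) * gamma_kernel 1 beta x.
Proof.
move=> x0.
have -> : (k`!%:R^-1)%:C * (u * x%:C) ^+ k = (k`!%:R^-1 * x ^+ k)%:C * u ^+ k.
  by rewrite exprMn rmorphM rmorphXn /=; ring.
rewrite projZ /term /gamma_kernel addrAC (@powRD _ x (beta - 1) k%:R);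
  last by rewrite (gt_eqF x0) implybT.
by rewrite powR_mulrn ?(ltW x0) //; ring.
Qed.

Lemma cexp_gamma_kernel u (beta : R) x : 0 < x ->
  proj (cexp ((u - 1) * x%:C) * ((x `^ (- beta))^-1 * x^-1)%:C) =
  proj (cexp (u * x%:C)) * gamma_kernel 1 beta x.
Proof.
move=> x0.
have -> : cexp ((u - 1) * x%:C) = (expR (- x))%:C * cexp (u * x%:C).
  rewrite mulrDl cexpD mulN1r mulrC; congr (_ * _).
  rewrite /cexp (_ : complex.Re (- x%:C) = - x) // (_ : complex.Im (- x%:C) = 0) ?oppr0 //.
    by rewrite cos0 sin0 mulr1.
  by rewrite /= oppr0.
rewrite mulrC mulrA -rmorphM projZ mulrC; congr (_ * _).
rewrite -powRN opprK /gamma_kernel mul1r; congr (_ * _).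
by rewrite powRB ?powRr1 ?(ltW x0) // (gt_eqF x0) implybT.
Qed.

Lemma cvg_gamma_terms (beta : R) u x : 0 < x ->
  \sum_(k < n) term beta u k x @[n --> \oo] -->
  proj (cexp (u * x%:C)) * gamma_kernel 1 beta x.
Proof.
move=> x0; have /proj_cvg c := @cvg_series_cexp R (u * x%:C).
rewrite (_ : (fun n => _) = fun n => proj (series (fun k =>
  (k`!%:R^-1)%:C * (u * x%:C) ^+ k) n) * gamma_kernel 1 beta x).
  exact: cvgMr_tmp.
apply/funext => n; rewrite /series /= big_mkord proj_sum mulr_suml.
by apply: eq_bigr => k _; exact: gamma_termE.
Qed.

(** Partial sums of [e ^ (u x)] are at most [e ^ (|u| x)] in modulus, which turns the
    rate 1 of the kernel into [1 - |u|]. *)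
Lemma gamma_terms_le (beta : R) u x n : 0 < x ->
  `|\sum_(k < n) term beta u k x| <= gamma_kernel (1 - normc u) beta x.
Proof.
move=> x0; apply: le_trans (ler_norm_sum _ _ _) _.
apply: (@le_trans _ _ ((\sum_(k < n) exp_coeff (normc u * x) k) * gamma_kernel 1 beta x)).
  rewrite mulr_suml; apply: ler_sum => k _.
  rewrite gamma_termE // normrM (ger0_norm (gamma_kernel_ge0 _ _ _)).
  apply: ler_wpM2r; first exact: gamma_kernel_ge0.
  apply: le_trans (proj_le _) _; rewrite Normc.normcM normcX Normc.normcM !normc_real.
  by rewrite !ger0_norm ?invr_ge0 ?(ltW x0) // exp_coeffE.
apply: (@le_trans _ _ (expR (normc u * x) * gamma_kernel 1 beta x)).
  apply: ler_wpM2r; first exact: gamma_kernel_ge0.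
  by apply: series_exp_coeff_le; rewrite mulr_ge0 ?normc_ge0 ?(ltW x0).
rewrite /gamma_kernel mulrCA -expRD.
by rewrite (_ : normc u * x + _ = - ((1 - normc u) * x)) //; ring.
Qed.

Lemma Rintegral_cexp_gamma (beta : R) u : 0 < beta -> normc u < 1 ->
  \int[mu]_(x in `]0%R, +oo[)
    proj (cexp ((u - 1) * x%:C) * ((x `^ (- beta))^-1 * x^-1)%:C) =
  proj ((Gamma beta)%:C * cpow (1 - u) (- beta)).
Proof.
move=> b0 u1.
have mD : measurable (`]0%R, +oo[%classic : set R) by exact: measurable_itv.
pose f x := proj (cexp (u * x%:C)) * gamma_kernel 1 beta x.
transitivity (\int[mu]_(x in `]0%R, +oo[) f x).
  apply: eq_Rintegral => x; rewrite inE /= in_itv /= andbT => x0.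
  exact: cexp_gamma_kernel.
pose F n x := \sum_(k < n) term beta u k x.
have mF n : measurable_fun (`]0%R, +oo[%classic : set R) (EFin \o F n).
  by case: (integral_gamma_terms u n b0) => /integrableP[].
have Ff x : `]0%R, +oo[%classic x -> (EFin \o F n) x @[n --> \oo] --> (EFin \o f) x.
  rewrite /= in_itv /= andbT => x0; apply: cvg_EFin; first exact: nearW.
  exact: cvg_gamma_terms.
have mf : measurable_fun (`]0%R, +oo[%classic : set R) (EFin \o f).
  exact: (emeasurable_fun_cvg _ _ mF Ff).
pose g x := (gamma_kernel (1 - normc u) beta x)%:E.
have ig : mu.-integrable `]0%R, +oo[ g.
  apply/integrableP; split; first by apply/measurable_EFinP; exact: measurable_gamma.
  under eq_integral => x _ do rewrite /= ger0_norm ?gamma_kernel_ge0 //.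
  by apply: gamma_integral_lty; rewrite ?subr_gt0.
have [||_ _ dc] := @dominated_convergence _ _ R mu _ mD (fun n => EFin \o F n)
  (EFin \o f) g mF mf _ ig _.
- by apply: aeW => x Dx; exact: Ff.
- apply: aeW => x n; rewrite /= in_itv /= andbT => x0.
  by rewrite lee_fin; exact: gamma_terms_le.
have val n : (\int[mu]_(x in `]0%R, +oo[) (EFin \o F n) x)%E =
    (\sum_(k < n) proj (u ^+ k) / k`!%:R * Gamma (beta + k%:R))%:E.
  have [i <-] := integral_gamma_terms u n b0.
  by rewrite /Rintegral fineK //; exact: integrable_fin_num.
have cv : \sum_(k < n) proj (u ^+ k) / k`!%:R * Gamma (beta + k%:R) @[n --> \oo] -->
    proj ((Gamma beta)%:C * cpow (1 - u) (- beta)).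
  rewrite projZ; have /proj_cvg c := cvg_binomial_series b0 u1.
  rewrite (_ : (fun n => _) = fun n => Gamma beta * proj (series (fun k =>
      (Gamma (beta + k%:R) / (k`!%:R * Gamma beta))%:C * u ^+ k) n)).
    exact: cvgMl_tmp.
  apply/funext => n; rewrite /series /= big_mkord proj_sum mulr_sumr.
  apply: eq_bigr => k _; rewrite projZ invfM.
  have G0 := lt0r_neq0 (Gamma_gt0 b0).
  move: (proj _) (Gamma (beta + _)) (k`!%:R^-1) => y1 y2 y3; by field.
have cv' : (\int[mu]_(x in `]0%R, +oo[) (EFin \o F n) x)%E @[n --> \oo] -->
    (proj ((Gamma beta)%:C * cpow (1 - u) (- beta)))%:E.
  rewrite (_ : (fun n => _) = EFin \o (fun n =>
    \sum_(k < n) proj (u ^+ k) / k`!%:R * Gamma (beta + k%:R))).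
    by apply: cvg_EFin; [exact: nearW|].
  by apply/funext => n; exact: val.
by rewrite /Rintegral (cvg_unique _ dc cv').
Qed.

End GammaIntegral.

Section CIntegral.
Variable R : realType.
Implicit Types (u : R[i]).

Theorem cintegral_cexp_gamma (beta : R) u : 0 < beta -> Normc.normc u < 1 ->
  cintegral `]0%R, +oo[ (fun x => cexp ((u - 1) * x%:C) *
    ((x `^ (- beta))^-1 * x^-1)%:C) =
  (Gamma beta)%:C * cpow (1 - u) (- beta).
Proof.
move=> b0 u1; apply: complexP.
  apply: (Rintegral_cexp_gamma (proj := @complex.Re R)) b0 u1.
  - by move=> n F; exact: Re_sum.
  - exact: ReZ.
  - exact: Re_le_normc.
  - by move=> s l /cvg_complexP[].
apply: (Rintegral_cexp_gamma (proj := @complex.Im R)) b0 u1.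
- by move=> n F; exact: Im_sum.
- exact: ImZ.
- exact: Im_le_normc.
- by move=> s l /cvg_complexP[].
Qed.

End CIntegral.

(** * Uniqueness of the coefficients of a power series *)

Section PowerSeriesInj.
Variable R : realType.
Implicit Types (d a : nat -> R) (z : R[i]).
Local Notation normc := (@Normc.normc R).

(** Divide by [x ^ n], where [n] is the index of the first nonzero coefficient, and
    let [x] tend to 0. *)
Lemma power_series_eq0 d :
  (forall x : R, 0 < x < 1 -> series (fun n => d n * x ^+ n) @ \oo --> (0 : R)) ->
  forall n, d n = 0.
Proof.
move=> hd n; have [N] := ubnP n; elim: N n => // N IH n nN.
have [B hB] : exists B : R, forall k, `|d k * 2^-1 ^+ k| <= B.
  have h2 : 0 < (2^-1 : R) < 1 by apply/andP; split; lra.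
  have : cvgn (series (fun k => d k * 2^-1 ^+ k)).
    by apply/cvg_ex; exists 0; exact: hd.
  move/cvg_series_bounded => [M [_ hM]]; exists (M + 1) => k.
  by apply: hM => //; rewrite ltrDl.
have B0 : 0 <= B by apply: le_trans (hB 0%N).
(* only the n-th term is not negligible as x tends to 0 *)
have key (y : R) : 0 < y <= 2^-1 -> `|d n| * 2^-1 ^+ n <= 2 * B * y.
  move=> /andP[y0 y2]; have y1 : y < 1 by lra.
  pose x := 2^-1 * y; have x01 : 0 < x < 1 by rewrite /x; lra.
  have x0 : 0 <= x by case/andP: x01 => /ltW.
  have tail M : \sum_(i < M) y ^+ i <= 2.
    have := subrX1 y M; rewrite -opprB -[y - 1]opprB mulNr => /oppr_inj e.
    have yM : 0 <= y ^+ M by rewrite exprn_ge0 // ltW.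
    have y1' : 0 < 1 - y by rewrite subr_gt0.
    rewrite -(ler_pM2l y1') -e; lra.
  have bound M : `|d n * x ^+ n| <=
      `|series (fun k => d k * x ^+ k) (M + n.+1)%N| + 2 * B * y ^+ n.+1.
    rewrite /series /= big_mkord addnC big_split_ord /= big_ord_recr /=.
    rewrite big1 ?add0r => [|i _]; last by rewrite IH ?mul0r // (leq_trans (ltn_ord i)).
    set rest := \sum_(i < M) _.
    have hrest : `|rest| <= 2 * B * y ^+ n.+1.
      apply: le_trans (ler_norm_sum _ _ _) _.
      apply: (@le_trans _ _ (\sum_(i < M) B * y ^+ n.+1 * y ^+ i)).
        apply: ler_sum => i _.
        rewrite /x exprMn mulrA normrM (ger0_norm (exprn_ge0 _ (ltW y0))) -mulrA -exprD.
        by apply: ler_wpM2r (hB _); rewrite exprn_ge0 // ltW.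
      rewrite -mulr_sumr [2 * B]mulrC [leRHS]mulrAC ler_wpM2l //.
      by rewrite mulr_ge0 // exprn_ge0 // ltW.
    have := ler_normB (d n * x ^+ n + rest) rest; rewrite addrK; lra.
  have lim : `|d n * x ^+ n| <= 0 + 2 * B * y ^+ n.+1.
    have c : series (fun k => d k * x ^+ k) (M + n.+1)%N @[M --> \oo] --> (0 : R).
      by rewrite (cvg_shiftn n.+1); exact: hd.
    have c' : `|series (fun k => d k * x ^+ k) (M + n.+1)%N| + 2 * B * y ^+ n.+1
        @[M --> \oo] --> 0 + 2 * B * y ^+ n.+1.
      by apply: cvgD; [rewrite -(@normr0 _ R); exact: cvg_norm|exact: cvg_cst].
    exact: (ler_cvg_to (cvg_cst _) c' (nearW _ bound)).
  move: lim; rewrite add0r normrM (ger0_norm (exprn_ge0 _ x0)) /x exprMn exprSr !mulrA.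
  by rewrite [leRHS]mulrAC ler_pM2r // exprn_gt0.
apply/eqP; rewrite -normr_le0 -(pmulr_lle0 _ (exprn_gt0 n (_ : 0 < 2^-1 :> R))) //.
have c : 2 * B * y @[y --> (0 : R)^'+] --> 2 * B * 0.
  by apply: cvg_at_right_filter; apply: cvgMl_tmp; exact: cvg_id.
rewrite -(mulr0 (2 * B)); apply: (ler_cvg_to (cvg_cst _) c).
near=> y; apply: key; apply/andP; split.
  by near: y; exact: nbhs_right_gt.
by near: y; apply: nbhs_right_le; rewrite invr_gt0.
Unshelve. all: by end_near. Qed.

Lemma generating_function_inj a b (G : R[i] -> R[i]) :
  (forall z, normc z < 1 ->
     series (fun n => (a n)%:C * z ^+ n : R[i]) @ \oo --> (G z : R[i]^o)) ->
  (forall z, normc z < 1 ->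
     series (fun n => (b n)%:C * z ^+ n : R[i]) @ \oo --> (G z : R[i]^o)) ->
  a =1 b.
Proof.
move=> ha hb n; apply/eqP; rewrite -subr_eq0; apply/eqP; move: n.
apply: (power_series_eq0 (d := fun n => a n - b n)) => x /andP[x0 x1].
have zx : normc x%:C < 1 by rewrite normc_real ger0_norm // ltW.
have re c : (fun n => complex.Re (series (fun n => (c n)%:C * x%:C ^+ n : R[i]) n)) =
    series (fun n => c n * x ^+ n).
  apply/funext => N; rewrite /series /= Re_sum; apply: eq_bigr => k _.
  by rewrite -rmorphXn ReZ.
have [ca _] := (cvg_complexP _ _).1 (ha _ zx).
have [cb _] := (cvg_complexP _ _).1 (hb _ zx).
rewrite re in ca; rewrite re in cb.
rewrite (_ : series _ = series (fun n => a n * x ^+ n) - series (fun n => b n * x ^+ n)).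
  by rewrite -(subrr (complex.Re (G x%:C))); exact: cvgB ca cb.
apply/funext => N; rewrite !fctE /series /= -sumrB; apply: eq_bigr => k _.
by rewrite mulrBl.
Qed.

Lemma cvg_gfZ (c : R) a z (w : R[i]) :
  series (fun n => (a n)%:C * z ^+ n : R[i]) @ \oo --> (w : R[i]^o) ->
  series (fun n => (c * a n)%:C * z ^+ n : R[i]) @ \oo --> (c%:C * w : R[i]^o).
Proof.
move=> /cvg_complexP[cr ci]; apply/cvg_complexP; rewrite ReZ ImZ.
have e N : series (fun n => (c * a n)%:C * z ^+ n) N =
    c%:C * series (fun n => (a n)%:C * z ^+ n) N.
  by rewrite /series /= mulr_sumr; apply: eq_bigr => k _; rewrite rmorphM mulrA.
by split; under eq_fun => N do rewrite e ?ReZ ?ImZ; exact: cvgMl_tmp.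
Qed.

End PowerSeriesInj.

(** * The invariant measures *)

Section EigenSequences.
Variable R : realType.
Implicit Types (a u : nat -> R) (nu : {measure set nat -> \bar R}).

Lemma convZ c a u n :
  conv (fderiv (fun k => c * a k)) u n = c * conv (fderiv a) u n.
Proof. by rewrite /conv mulr_sumr; apply: eq_bigr => k _; rewrite /fderiv; ring. Qed.

Lemma eigen_proportional u theta a b : u 0%N != 0 -> b 0%N = 1 ->
  (forall n, conv (fderiv b) u n = theta * b n) ->
  (forall n, conv (fderiv a) u n = theta * a n) <->
  (forall n, a n = a 0%N * b n).
Proof.
move=> u0 b0 hb; split=> [ha|e n].
  apply: (eigen_unique u0 ha) => [n|]; last by rewrite b0 mulr1.
  by rewrite convZ hb mulrCA.
have ea : a = fun k => a 0%N * b k by apply/funext.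
by rewrite {1}ea convZ hb [a n]e mulrCA.
Qed.

Lemma conv_fderiv_dirac0 u n : conv (fderiv (fun k => (k == 0%N)%:R)) u n = 0.
Proof. by rewrite /conv big1 // => k _; rewrite /fderiv mulr0 mul0r. Qed.

Lemma multiple_of_measure (g : R) a nu nu0 : 0 < g -> a 0%N = 1 ->
  locally_finite nu -> locally_finite nu0 ->
  (forall n, mass nu0 n = g * a n) ->
  (forall n, mass nu n = mass nu 0 * a n) <->
  exists2 c : R, 0 <= c & forall A, (nu A = c%:E * nu0 A)%E.
Proof.
move=> g0 a0 fin fin0 mass0; split=> [e|[c c0 /(massZ_measure c0 fin fin0) e] n].
  have c0 : 0 <= mass nu 0 / g by rewrite divr_ge0 ?mass_ge0 // ltW.
  exists (mass nu 0 / g) => //; apply/(massZ_measure c0 fin fin0) => n.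
  by rewrite mass0 mulrA divfK ?gt_eqF //; exact: e.
by rewrite (e n) (e 0%N) !mass0 a0 mulr1 mulrA.
Qed.

Lemma dirac0_set1 n : (\d_0%N : {measure set nat -> \bar R}) [set n] =
  (n == 0%N)%:R%:E.
Proof.
rewrite -[LHS]/(\d_0%N [set n]) diracE; case: (eqVneq n 0%N) => [->|n0].
  by rewrite mem_set.
by rewrite memNset //= => e; rewrite -e eqxx in n0.
Qed.

End EigenSequences.

Section Process.
Context (R : realType) (d : measure_display) (T : measurableType d).
Context (r : R) (p : nat -> R) (P : R -> nat -> nat -> R).
Context (Pr : nat -> probability T R) (Z : R -> T -> nat).
Context (m : R) (nu_min : probability nat R).
Hypothesis hZ : is_BGW r p P Pr Z.
Hypothesis hm : 0 < m.
Hypothesis hE : forall t : R, 0 <= t ->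
  'E_(Pr 1%N)[(fun w => (Z t w)%:R : R)]%E = (expR (- m * t))%:E.
Hypothesis hY : is_yaglom_limit (Pr 1%N) Z nu_min.

Lemma mass_probability k : nu_min (id @^-1` [set k]) = (mass nu_min k)%:E.
Proof. by rewrite /mass fineK // fin_num_measure. Qed.

Lemma marginal_law (t : R) k : 0 <= t ->
  Pr 1%N (Z t @^-1` [set k]) = (P t 1%N k)%:E.
Proof.
move=> t0; have [_ /(_ 1%N [:: (t, k)])] := bgw_markov hZ.
rewrite /= t0 subr0 mulr1 => /(_ isT) <-; congr (Pr 1%N _).
by apply/seteqP; split=> w /=; rewrite andbT => /eqP.
Qed.

Lemma mass_yaglom_le1 n : \sum_(k < n) mass nu_min k <= 1.
Proof.
apply: sum_le_cvg_series; first exact: mass_ge0.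
exact: (law_cvg1 (X := id) _ mass_probability).
Qed.

Lemma mass_yaglom0 : mass nu_min 0 = 0.
Proof. by case: hY => h _; rewrite /mass -[X in fine X]/(nu_min [set 0%N]) h. Qed.

(** The equation of [yaglom_generator] for the given process: the
    law of [Z t] under [Pr 1] is [P t 1]. *)
Lemma yaglom_eigen n : conv (fderiv (mass nu_min)) (drift r p) n =
  m * ((n == 0)%:R - mass nu_min n).
Proof.
have mZ (t : R) : 0 <= t -> measurable_fun [set: T] (Z t).
  by move=> t0; case: (bgw_markov hZ) => h _; exact: h.
have law (t : R) (t0 : 0 <= t) k := marginal_law k t0.
apply: (@yaglom_generator _ P (bgw_semigroup hZ) (bgw_branching hZ)
  (bgw_absorbing0 hZ) m _ hm (mass nu_min) mass_yaglom0 (mass_ge0 _)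
  mass_yaglom_le1 _ r p (bgw_infinitesimal hZ)).
  move=> t t0; exact: (cvg_law_expectation (mZ t t0) (law t t0) (hE t0)).
move=> g V g01 g0 hV; exists (\int[nu_min]_n g n).
  exact: (cvg_law_integral (X := id) _ mass_probability g01).
case: hY => _ /(_ g) hg.
have /hg : exists M : R, forall n, `|g n| <= M.
  by exists 1 => k; have /andP[h0 h1] := g01 k; rewrite ger0_norm.
apply: cvg_near_eq; near=> t.
have t0 : 0 <= t by near: t; apply: nbhs_pinfty_ge; exact: num_real.
have cI := cvg_law_integral_pos (mZ t t0) (law t t0) g01 g0.
congr (_ / _); first exact: (cvg_unique _ cI (hV t t0)).
rewrite -[survival P t]/(fine (1 - P t 1%N 0%N)%:E); congr fine.
exact: (law_gt0E (mZ t t0) (law t t0)).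
Unshelve. all: by end_near. Qed.

End Process.

Theorem corollary12 (R : realType) (d : measure_display) (T : measurableType d)
    (r : R) (p : nat -> R) (P : R -> nat -> nat -> R)
    (Pr : nat -> probability T R) (Z : R -> T -> nat)
    (m : R) (nu_min : probability nat R) (H : R[i] -> R[i])
    (hZ : is_BGW r p P Pr Z)
    (hsub : subcritical p)
    (hm : 0 < m)
    (hE : forall t : R, 0 <= t ->
       'E_(Pr 1%N)[(fun w => (Z t w)%:R : R)]%E = (expR (- m * t))%:E)
    (hY : is_yaglom_limit (Pr 1%N) Z nu_min)
    (hH : has_generating_function nu_min H) :
  let L0 := bgw_generator r p in
  [/\ forall (lambda : R) (nu : {measure set nat -> \bar R}),
        0 < lambda -> locally_finite nu -> true_invariant L0 lambda nu ->
        forall A : set nat, nu A = 0%E,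
      forall nu : {measure set nat -> \bar R}, locally_finite nu ->
        (true_invariant L0 0 nu <->
         exists2 c : R, 0 <= c & forall A, nu A = (c%:E * \d_0%N A)%E) &
      forall lambda : R, lambda < 0 ->
        let alpha := lambda / m in
        exists nu0 : {measure set nat -> \bar R},
          [/\ locally_finite nu0,
              has_generating_function nu0 (fun z =>
                cintegral `]0, +oo[ (fun x =>
                  cexp ((H z - 1) * x%:C) * ((x `^ alpha)^-1 * x^-1)%:C)),
              forall nu : {measure set nat -> \bar R}, locally_finite nu ->
                (true_invariant L0 lambda nu <->
                 exists2 c : R, 0 <= c & forall A, nu A = (c%:E * nu0 A)%E) &
              forall nu : {measure set nat -> \bar R}, locally_finite nu ->
                (true_invariant L0 lambda nu <->
                 exists2 c : R, 0 <= c &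
                   has_generating_function nu
                     (fun z => c%:C * cpow (1 - H z) alpha))]].
Proof.
move=> L0.
have pmf_p := bgw_offspring hZ.
have p0 : drift r p 0 != 0.
  by rewrite /drift subr0 mulf_neq0 ?gt_eqF ?(bgw_rate_gt0 hZ) ?subcritical_p0.
have u0 : 0 < drift r p 0.
  by rewrite /drift subr0 mulr_gt0 ?(bgw_rate_gt0 hZ) ?subcritical_p0.
split.
- move=> lambda nu l0 fin /true_invariantE inv.
  (* the equation at 0 reads r p_0 nu(1) = - lambda nu(0) *)
  have nu0 : mass nu 0 = 0.
    have := inv 0%N; rewrite /conv big_ord_recl big_ord0 addr0 /fderiv mul1r => e.
    have n1 : 0 <= mass nu 1 * drift r p 0 by rewrite mulr_ge0 ?mass_ge0 // ltW.
    apply/eqP; rewrite eq_le mass_ge0 andbT -(pmulr_rle0 _ l0).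
    by rewrite e mulNr oppr_ge0 in n1.
  have z : mass nu =1 fun=> 0.
    apply: (eigen_unique p0 inv) => // n.
    by rewrite /conv mulr0 big1 // => k _; rewrite /fderiv mulr0 mul0r.
  move=> A; rewrite measure_natE eseries0 // => n _ _.
  by rewrite massE // z.
- move=> nu fin; rewrite true_invariantE oppr0.
  pose delta0 : {measure set nat -> \bar R} := \d_0%N.
  have mass0 n : mass delta0 n = 1 * (n == 0%N)%:R.
    by rewrite /mass dirac0_set1 mul1r.
  have fin0 : locally_finite delta0 by move=> n; rewrite dirac0_set1 ltry.
  rewrite -(multiple_of_measure ltr01 _ fin fin0 mass0) //.
  apply: (@eigen_proportional R _ 0 _ (fun n => (n == 0%N)%:R)) => //.
  by move=> n; rewrite conv_fderiv_dirac0 mul0r.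
move=> lambda l0 alpha.
pose beta := - alpha.
have b0 : 0 < beta by rewrite oppr_gt0 pmulr_llt0 ?invr_gt0.
have bE : beta * m = - lambda.
  by rewrite /beta /alpha mulNr divfK // gt_eqF.
pose h := mass nu_min.
have h_ge0 : forall n, 0 <= h n := mass_ge0 nu_min.
have h0 : h 0%N = 0 := mass_yaglom0 hY.
have h1 : forall n, \sum_(k < n) h k <= 1 := mass_yaglom_le1 nu_min.
have [a ha] := neg_power_exists beta h.
have a_ge0 := neg_power_ge0 (ltW b0) h_ge0 ha.
have a_eigen n : conv (fderiv a) (drift r p) n = - lambda * a n.
  by rewrite (neg_power_eigen h0 ha (yaglom_eigen hZ hm hE hY)) bE.
have G0 := Gamma_gt0 b0.
have [nu0 [fin0 mass0]] := measure_of_mass (fun n => mulr_ge0 (ltW G0) (a_ge0 n)).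
have lt1 (z : R[i]) : (`|z| < 1) = (Normc.normc z < 1).
  by rewrite normcE (ltcR _ 1).
have H_lt1 (z : R[i]) : Normc.normc z < 1 -> Normc.normc (H z) < 1.
  move=> z1; apply: le_lt_trans (z1); apply: (normc_gf_le h_ge0 h0 h1 (ltW z1)).
  by apply: hH; rewrite lt1.
have gfa (z : R[i]) : Normc.normc z < 1 ->
    series (fun n => (a n)%:C * z ^+ n : R[i]) @ \oo --> (cpow (1 - H z) alpha : R[i]^o).
  move=> z1; rewrite -[alpha]opprK.
  apply: (neg_power_cpow (ltW b0) h_ge0 h0 h1 ha z1).
  by apply: hH; rewrite lt1.
have eigenE (nu : {measure set nat -> \bar R}) :
    true_invariant L0 lambda nu <-> forall n, mass nu n = mass nu 0 * a n.
  by rewrite true_invariantE (eigen_proportional _ p0 _ a_eigen) //; case: ha.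
exists nu0; split; first exact: fin0.
- move=> z; rewrite lt1 => z1.
  rewrite -[alpha]opprK -/beta (cintegral_cexp_gamma b0 (H_lt1 z z1)) opprK.
  rewrite (_ : mass nu0 = fun n => Gamma beta * a n); last by apply/funext.
  exact: cvg_gfZ (gfa z z1).
- move=> nu fin; rewrite eigenE.
  by apply: (multiple_of_measure G0 _ fin fin0 mass0); case: ha.
- move=> nu fin; rewrite eigenE; split=> [e|[c c0 gfc] n].
    exists (mass nu 0); first exact: mass_ge0.
    move=> z; rewrite lt1 => z1.
    rewrite (_ : (fun n => _) = fun n => (mass nu 0 * a n)%:C * z ^+ n); last first.
      by apply/funext => n; rewrite -e.
    exact: cvg_gfZ (gfa z z1).
  have e : mass nu =1 fun n => c * a n.
    apply: (generating_function_inj (G := fun z => c%:C * cpow (1 - H z) alpha)).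
      by move=> z z1; apply: gfc; rewrite lt1.
    by move=> z z1; exact: cvg_gfZ (gfa z z1).
  by rewrite (e n) (e 0%N); case: ha => -> _; rewrite mulr1.
Qed.
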